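(* Let $A=\mathbf{k}\mathcal{Q}/\mathcal{I}$ be a gentle algebra, let $C:=A^{\mathrm{CMA}}$ be its Cohen--Macaulay Auslander algebra, and let $\epsilon_\star\in C$ be the sum of the primitive idempotents of $C$ corresponding to the vertices in $\mathcal{Q}_0$. Then the following hold. (1) There is a recollement $\mathcal{R}(C,\epsilon_\star)$ of the module categories $\mathsf{mod}(C/C\epsilon_\star C)$, $\mathsf{mod}(C)$ and $\mathsf{mod}(A)$, where $A$ is identified with $\epsilon_\star C\epsilon_\star$ and the functors are: the embedding $\mathsf{mod}(C/C\epsilon_\star C)\to \mathsf{mod}(C)$ with left adjoint $-\otimes_C C/C\epsilon_\star C$ and right adjoint $\mathrm{Hom}_C(C/C\epsilon_\star C,-)$; and the restriction $\mathrm{res}_{\epsilon_\star}=(-)\epsilon_\star:\mathsf{mod}(C)\to\mathsf{mod}(A)$ with left adjoint $-\otimes_A\epsilon_\star C$ and right adjoint $\mathrm{Hom}_A(C\epsilon_\star,-)$. (2) For every indecomposable non-projective Gorenstein-projective $A$-module $G$, with corresponding vertex $v$ of the quiver of $C$, the $A$-module $\mathrm{res}_{\epsilon_\star}(e_vC)$ is Gorenstein-projective. (3) For every indecomposable non-projective Gorenstein-projective $A$-module $G$, the $C$-module $G\otimes_A\epsilon_\star C$ is not Gorenstein-projective.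
   Context: $\mathbf{k}$ is an algebraically closed field; algebras are finite-dimensional over $\mathbf{k}$; modules are finitely generated right modules; $\mathsf{mod}(\Lambda)$ is the category of such $\Lambda$-modules. For arrows $a,b$ of a quiver with ending point $\mathfrak{t}(a)$ equal to the starting point $\mathfrak{s}(b)$, the path ''first $a$, then $b$'' is written $ab$. $e_v$ is the idempotent of a vertex $v$. Gentle algebra: a finite-dimensional algebra $A=\mathbf{k}\mathcal{Q}/\mathcal{I}$ with $\mathcal{Q}$ a finite quiver and $\mathcal{I}$ an admissible ideal such that: (G1) every vertex has at most two incoming and at most two outgoing arrows; (G2) for arrows $a\neq b$ and $c$ with $\mathfrak{t}(a)=\mathfrak{t}(b)=\mathfrak{s}(c)$, exactly one of $ac,bc$ lies in $\mathcal{I}$; (G3) for arrows $a\ne b$ and $c$ with $\mathfrak{s}(a)=\mathfrak{s}(b)=\mathfrak{t}(c)$, exactly one of $ca,cb$ lies in $\mathcal{I}$; (G4) $\mathcal{I}$ is generated by paths of length two. Forbidden cycle: an oriented cycle $c_1\cdots c_n$ ($n\ge1$) in $\mathcal{Q}$ with $c_ic_{i+1}\in\mathcal{I}$ for $1\le i<n$ and $c_nc_1\in\mathcal{I}$. Gorenstein-projective ($G$-projective) module $G$ over $\Lambda$: there is an exact complex $P_\bullet$ of projective $\Lambda$-modules, unbounded in both directions, with $\mathrm{Hom}_\Lambda(P_\bullet,\Lambda)$ exact and $G$ isomorphic to the image of one of its differentials. For a gentle algebra $A$ the indecomposable non-projective $G$-projective modules are, up to isomorphism, exactly the modules $cA$,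 with $c$ an arrow on a forbidden cycle (Kalck). Cohen--Macaulay Auslander algebra $A^{\mathrm{CMA}}$ of a gentle algebra $A$: the endomorphism algebra (up to the side convention on opposite algebras) of the direct sum of all indecomposable $G$-projective $A$-modules, one from each isomorphism class. It is presented (Chen--Lu) as $A^{\mathrm{CMA}}=\mathbf{k}\mathcal{Q}^{\mathrm{CMA}}/\mathcal{I}^{\mathrm{CMA}}$, where: the vertices of $\mathcal{Q}^{\mathrm{CMA}}$ are those of $\mathcal{Q}$ together with one new vertex for each $cA$, $c$ an arrow on a forbidden cycle (the vertex corresponding to the $G$-projective module $cA$); the arrows are the arrows of $\mathcal{Q}$ not on any forbidden cycle, together with, for each arrow $c$ on a forbidden cycle, an arrow $c^-$ from $\mathfrak{s}(c)$ to the vertex of $cA$ and an arrow $c^+$ from the vertex of $cA$ to $\mathfrak{t}(c)$; $\mathcal{I}^{\mathrm{CMA}}$ is generated by the paths $ab\in\mathcal{I}$ with neither $a$ nor $b$ on a forbidden cycle and the paths $c^+d^-$ for $c,d$ arrows on forbidden cycles with $cd\in\mathcal{I}$. The identification $A\cong\epsilon_\star C\epsilon_\star$ sends an arrow $c$ on a forbidden cycle to $c^-c^+$ and every other arrow to itself. If there is no forbidden cycle, then $\epsilon_\star=1$. *)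

(* Defs.v *)
From HB Require Import structures.
From mathcomp Require Import all_boot all_algebra.
From mathcomp Require Import boolp finmap monalg.

Set Implicit Arguments.
Unset Strict Implicit.
Unset Printing Implicit Defensive.

Import GRing.Theory.
Local Open Scope ring_scope.
Local Open Scope quotient_scope.

(* Rings are [pzRingType]s: the zero ring is allowed, since C/CeC is zero when
   A has no nonprojective indecomposable Gorenstein-projective module.
   The k-structures of algebras and modules are not recorded: two-sided ideals
   of kQ, modules over kQ/I and their morphisms are k-linear automatically. *)

Definition subgroup_closed (V : zmodType) (P : V -> Prop) : Prop :=
  P 0 /\ forall x y, P x -> P y -> P (x - y).

Record subgroup (V : zmodType) := Subgroup {
  subgroup_set :> V -> Prop;
  subgroupP : subgroup_closed subgroup_set }.

Definition subgroup_mem (V : zmodType) (P : subgroup V) : V -> bool :=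
  fun x => `[< P x >].

Lemma subgroup_mem_closed (V : zmodType) (P : subgroup V) :
  zmod_closed (subgroup_mem P).
Proof.
case: P => P [P0 PB]; split; first exact/asboolP.
by move=> x y /asboolP Px /asboolP Py; apply/asboolP/PB.
Qed.

HB.instance Definition _ (V : zmodType) (P : subgroup V) :=
  GRing.isZmodClosed.Build V (subgroup_mem P) (subgroup_mem_closed P).

Definition subgroup_pred (V : zmodType) (P : subgroup V) : zmodClosed V :=
  GRing.ZmodClosed.clone V (subgroup_mem P) _.

Definition zquot (V : zmodType) (P : subgroup V) : Type :=
  Quotient.quot (subgroup_pred P).

HB.instance Definition _ (V : zmodType) (P : subgroup V) :=
  GRing.Zmodule.on (zquot P).

Definition zpi (V : zmodType) (P : subgroup V) : V -> zquot P :=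
  \pi_(Quotient.quot (subgroup_pred P)).

Section ZquotTheory.
Variables (V : zmodType) (P : subgroup V).

Lemma zpi_zmod_morphism : zmod_morphism (@zpi V P).
Proof. exact: (@pi_is_zmod_morphism _ _ _ (Quotient.quot (subgroup_pred P))). Qed.

HB.instance Definition _ :=
  GRing.isZmodMorphism.Build V (zquot P) (@zpi V P) zpi_zmod_morphism.

Lemma zpi_eq (x y : V) : zpi P x = zpi P y <-> P (x - y).
Proof.
rewrite /zpi; split=> [/eqP|Pxy].
  by rewrite -Quotient.idealrBE => /asboolP.
by apply/eqP; rewrite -Quotient.idealrBE; apply/asboolP.
Qed.

Lemma zpi_eq0 (x : V) : zpi P x = 0 <-> P x.
Proof. by rewrite -{2}[x]subr0 -zpi_eq raddf0. Qed.

Definition zrepr (u : zquot P) : V := repr (u : Quotient.quot (subgroup_pred P)).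

Lemma zreprK : cancel zrepr (@zpi V P).
Proof. by move=> u; rewrite /zpi /zrepr reprK. Qed.

Lemma zreprP (x : V) : P (zrepr (zpi P x) - x).
Proof. by apply/zpi_eq; rewrite zreprK. Qed.
End ZquotTheory.

Definition span_set (V : zmodType) (S : V -> Prop) (x : V) : Prop :=
  forall P : subgroup V, (forall y, S y -> P y) -> P x.

Lemma span_set_closed (V : zmodType) (S : V -> Prop) :
  subgroup_closed (span_set S).
Proof.
split=> [P _|x y Sx Sy P SP]; first exact: (subgroupP P).1.
by apply: (subgroupP P).2; [apply: Sx | apply: Sy].
Qed.

Definition span_subgroup (V : zmodType) (S : V -> Prop) : subgroup V :=
  Subgroup (span_set_closed S).

Record ideal (R : pzRingType) := Ideal {
  ideal_subgroup :> subgroup R;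
  idealMl : forall a x, ideal_subgroup x -> ideal_subgroup (a * x);
  idealMr : forall a x, ideal_subgroup x -> ideal_subgroup (x * a) }.

Section IdealGen.
Variables (R : pzRingType) (S : R -> Prop).

Definition ideal_gen_set (x : R) : Prop :=
  forall I : ideal R, (forall y, S y -> I y) -> I x.

Lemma ideal_gen_closed : subgroup_closed ideal_gen_set.
Proof.
split=> [I _|x y Sx Sy I SI]; first exact: (subgroupP I).1.
by apply: (subgroupP I).2; [apply: Sx | apply: Sy].
Qed.

Lemma ideal_genMl a x : ideal_gen_set x -> ideal_gen_set (a * x).
Proof. by move=> Sx I SI; apply/idealMl/Sx. Qed.

Lemma ideal_genMr a x : ideal_gen_set x -> ideal_gen_set (x * a).
Proof. by move=> Sx I SI; apply/idealMr/Sx. Qed.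

Definition ideal_gen : ideal R :=
  @Ideal R (Subgroup ideal_gen_closed) ideal_genMl ideal_genMr.
End IdealGen.

Definition rquot (R : pzRingType) (I : ideal R) : Type := zquot I.

HB.instance Definition _ (R : pzRingType) (I : ideal R) :=
  GRing.Zmodule.on (rquot I).

Section RquotRing.
Variables (R : pzRingType) (I : ideal R).

Definition rpi : R -> rquot I := @zpi R I.
HB.instance Definition _ :=
  GRing.isZmodMorphism.Build R (rquot I) rpi (@zpi_zmod_morphism R I).

Definition rquot_mul (u v : rquot I) : rquot I := rpi (zrepr u * zrepr v).

Lemma rpiM x y : rpi (x * y) = rquot_mul (rpi x) (rpi y).
Proof.
apply/esym/zpi_eq; rewrite -[_ * _](addrNK (x * zrepr (rpi y))) -mulrBl.
rewrite -addrA -mulrBr -[x * _]opprK.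
apply: (subgroupP I).2; first exact/idealMr/zreprP.
by rewrite -mulrN; apply: idealMl; rewrite -sub0r;
  apply: (subgroupP I).2 (zreprP _ _); case: (subgroupP I).
Qed.

Lemma rpi_surj (u : rquot I) : exists x, u = rpi x.
Proof. by exists (zrepr u); rewrite /rpi zreprK. Qed.

Lemma rquot_mulA : associative rquot_mul.
Proof.
move=> u v w; have [x ->] := rpi_surj u; have [y ->] := rpi_surj v.
by have [z ->] := rpi_surj w; rewrite -!rpiM mulrA.
Qed.

Lemma rquot_mul1l : left_id (rpi 1) rquot_mul.
Proof. by move=> u; have [x ->] := rpi_surj u; rewrite -rpiM mul1r. Qed.

Lemma rquot_mul1r : right_id (rpi 1) rquot_mul.
Proof. by move=> u; have [x ->] := rpi_surj u; rewrite -rpiM mulr1. Qed.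

Lemma rquot_mulDl : left_distributive rquot_mul +%R.
Proof.
move=> u v w; have [x ->] := rpi_surj u; have [y ->] := rpi_surj v.
by have [z ->] := rpi_surj w; rewrite -raddfD -!rpiM mulrDl raddfD.
Qed.

Lemma rquot_mulDr : right_distributive rquot_mul +%R.
Proof.
move=> u v w; have [x ->] := rpi_surj u; have [y ->] := rpi_surj v.
by have [z ->] := rpi_surj w; rewrite -raddfD -!rpiM mulrDr raddfD.
Qed.

HB.instance Definition _ := GRing.Zmodule_isPzRing.Build (rquot I)
  rquot_mulA rquot_mul1l rquot_mul1r rquot_mulDl rquot_mulDr.

Lemma rpi_monoid_morphism : monoid_morphism rpi.
Proof. by split=> // x y; rewrite rpiM. Qed.

HB.instance Definition _ :=
  GRing.isMonoidMorphism.Build R (rquot I) rpi rpi_monoid_morphism.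
End RquotRing.

Record quiver := Quiver {
  vertex : finType;
  arrow : finType;
  src : arrow -> vertex;
  tgt : arrow -> vertex }.
Arguments src {q} _.
Arguments tgt {q} _.

Section Paths.
Variable Q : quiver.

Fixpoint walk (v : vertex Q) (p : seq (arrow Q)) : bool :=
  if p is a :: p' then (src a == v) && walk (tgt a) p' else true.

(* A path is its starting vertex with its arrows, listed in the order in which
   they are travelled; the empty list gives the trivial path. *)
Definition qpath := {p : vertex Q * seq (arrow Q) | walk p.1 p.2}.
HB.instance Definition _ := Choice.on qpath.

Definition psrc (p : qpath) : vertex Q := (val p).1.
Definition parr (p : qpath) : seq (arrow Q) := (val p).2.
Definition ptgt (p : qpath) : vertex Q := last (psrc p) (map tgt (parr p)).
Definition plen (p : qpath) : nat := size (parr p).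

Definition ptriv (v : vertex Q) : qpath := exist _ (v, [::]) isT.

Lemma parrow_walk (a : arrow Q) : walk (src a) [:: a].
Proof. by rewrite /= eqxx. Qed.
Definition parrow (a : arrow Q) : qpath :=
  exist _ (src a, [:: a]) (parrow_walk a).

(* Only meaningful when ptgt p = psrc q; see [pmul]. *)
Definition pcat (p q : qpath) : qpath := insubd p (psrc p, parr p ++ parr q).

Lemma walk_cat v p q :
  walk v (p ++ q) = walk v p && walk (last v (map tgt p)) q.
Proof. by elim: p v => //= a p IH v; rewrite IH andbA. Qed.

Lemma val_pcat p q : ptgt p = psrc q -> val (pcat p q) = (psrc p, parr p ++ parr q).
Proof.
move=> pq; rewrite val_insubd /= walk_cat.
by have := valP p; have := valP q; rewrite -/(psrc q) -/(psrc p) -pq => -> ->.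
Qed.

Lemma psrc_pcat p q : ptgt p = psrc q -> psrc (pcat p q) = psrc p.
Proof. by move=> pq; rewrite {1}/psrc val_pcat. Qed.

Lemma parr_pcat p q : ptgt p = psrc q -> parr (pcat p q) = parr p ++ parr q.
Proof. by move=> pq; rewrite {1}/parr val_pcat. Qed.

Lemma ptgt_pcat p q : ptgt p = psrc q -> ptgt (pcat p q) = ptgt q.
Proof.
move=> pq; rewrite /ptgt psrc_pcat // parr_pcat // map_cat last_cat.
by rewrite -/(ptgt p) pq.
Qed.

Lemma qpath_eq (p q : qpath) : psrc p = psrc q -> parr p = parr q -> p = q.
Proof.
move=> s a; apply/val_inj; move: s a; rewrite /psrc /parr.
by case: (val p) (val q) => [? ?] [? ?] /= -> ->.
Qed.
End Paths.

Section PathAlgebra.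
Variables (k : fieldType) (Q : quiver).
Local Notation path := (qpath Q).

Local Notation kQ := {malg k[path]}.

Definition pmul (p q : path) (c : k) : kQ :=
  if ptgt p == psrc q then << c *g pcat p q >> else 0.

Lemma pmul0 p q : pmul p q 0 = 0.
Proof. by rewrite /pmul monalgU0 if_same. Qed.

Lemma pmulD p q c d : pmul p q (c + d) = pmul p q c + pmul p q d.
Proof. by rewrite /pmul; case: (_ == _); [exact: monalgUD | rewrite [RHS]addr0]. Qed.

Definition path_alg_mul (x y : kQ) : kQ :=
  \sum_(p <- msupp x) \sum_(q <- msupp y) pmul p q (x@_p * y@_q).
Definition path_alg_one : kQ := \sum_v << ptriv v >>.

Local Notation mul := path_alg_mul.
Implicit Types (x y z : kQ).

Lemma path_mulw (d1 d2 : {fset path}) x y :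
  (msupp x `<=` d1)%fset -> (msupp y `<=` d2)%fset ->
  mul x y = \sum_(p <- d1) \sum_(q <- d2) pmul p q (x@_p * y@_q).
Proof.
move=> le1 le2; rewrite /mul (big_fset_incl _ le1) /=.
  apply: eq_bigr => p _; apply/big_fset_incl => // q _ /mcoeff_outdom ->.
  by rewrite mulr0 pmul0.
move=> p _ /mcoeff_outdom xp.
by rewrite big1 // => q _; rewrite xp mul0r pmul0.
Qed.

Lemma path_mulDl : left_distributive mul +%R.
Proof.
move=> x y z.
rewrite (@path_mulw (msupp x `|` msupp y)%fset (msupp z)) ?msuppD_le //.
rewrite (@path_mulw (msupp x `|` msupp y)%fset (msupp z) x) ?fsubsetUl //.
rewrite (@path_mulw (msupp x `|` msupp y)%fset (msupp z) y) ?fsubsetUr //.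
rewrite -big_split; apply: eq_bigr => p _ /=; rewrite -big_split.
by apply: eq_bigr => q _ /=; rewrite mcoeffD mulrDl pmulD.
Qed.

Lemma path_mulDr : right_distributive mul +%R.
Proof.
move=> z x y.
rewrite (@path_mulw (msupp z) (msupp x `|` msupp y)%fset) ?msuppD_le //.
rewrite (@path_mulw (msupp z) (msupp x `|` msupp y)%fset _ x) ?fsubsetUl //.
rewrite (@path_mulw (msupp z) (msupp x `|` msupp y)%fset _ y) ?fsubsetUr //.
rewrite -big_split; apply: eq_bigr => p _ /=; rewrite -big_split.
by apply: eq_bigr => q _ /=; rewrite mcoeffD mulrDr pmulD.
Qed.

Lemma path_mul0l : left_zero 0 mul.
Proof. by move=> x; rewrite /mul msupp0 big_seq_fset0. Qed.

Lemma path_mul0r : right_zero 0 mul.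
Proof. by move=> x; rewrite /mul big1 // => p _; rewrite msupp0 big_seq_fset0. Qed.

Lemma path_mul_suml I (r : seq I) (F : I -> kQ) y :
  mul (\sum_(i <- r) F i) y = \sum_(i <- r) mul (F i) y.
Proof.
exact: (big_morph (mul^~ y) (fun _ _ => path_mulDl _ _ _) (path_mul0l _)).
Qed.

Lemma path_mul_sumr I (r : seq I) (F : I -> kQ) x :
  mul x (\sum_(i <- r) F i) = \sum_(i <- r) mul x (F i).
Proof.
exact: (big_morph (mul x) (fun _ _ => path_mulDr _ _ _) (path_mul0r _)).
Qed.

Lemma path_mulUU c d p q :
  mul << c *g p >> << d *g q >> = pmul p q (c * d).
Proof.
rewrite (@path_mulw [fset p]%fset [fset q]%fset) ?msuppU_le //.
by rewrite !big_seq_fset1 !mcoeffUU.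
Qed.

Lemma path_alg_ind (f g : kQ -> kQ) :
  (forall x y, f (x + y) = f x + f y) -> (forall x y, g (x + y) = g x + g y) ->
  (forall c p, f << c *g p >> = g << c *g p >>) -> f =1 g.
Proof.
move=> fD gD fg x.
have f0 : f 0 = 0 by apply: (addrI (f 0)); rewrite -fD !addr0.
have g0 : g 0 = 0 by apply: (addrI (g 0)); rewrite -gD !addr0.
rewrite [x]monalgE (big_morph f fD f0) (big_morph g gD g0).
by apply: eq_bigr => p _; rewrite fg.
Qed.

Lemma path_mulA : associative mul.
Proof.
move=> x y z.
refine (@path_alg_ind (fun x => mul x (mul y z))
  (fun x => mul (mul x y) z) _ _ _ x) => [{}x x'|{}x x'|a p].
- by rewrite path_mulDl.
- by rewrite 2!path_mulDl.
refine (@path_alg_ind (fun y => mul << a *g p >> (mul y z))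
  (fun y => mul (mul << a *g p >> y) z) _ _ _ y) => [{}y y'|{}y y'|b q].
- by rewrite path_mulDl path_mulDr.
- by rewrite path_mulDr path_mulDl.
refine (@path_alg_ind (fun z => mul << a *g p >> (mul << b *g q >> z))
  (mul (mul << a *g p >> << b *g q >>)) _ _ _ z) => [{}z z'|{}z z'|c r].
- exact: etrans (congr1 _ (path_mulDr _ _ _)) (path_mulDr _ _ _).
- by rewrite path_mulDr.
refine (etrans (congr1 (mul _) (path_mulUU _ _ _ _)) _).
refine (etrans _ (esym (congr1 (mul^~ _) (path_mulUU _ _ _ _)))); rewrite /pmul.
have [qr|nqr] := eqVneq (ptgt q) (psrc r); have [pq|npq] := eqVneq (ptgt p) (psrc q).
- refine (etrans (path_mulUU _ _ _ _) (etrans _ (esym (path_mulUU _ _ _ _)))).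
  have pqr : ptgt p = psrc (pcat q r) by rewrite psrc_pcat.
  have pq_r : ptgt (pcat p q) = psrc r by rewrite ptgt_pcat.
  rewrite /pmul (psrc_pcat qr) (ptgt_pcat pq) pq qr !eqxx mulrA.
  suff -> : pcat p (pcat q r) = pcat (pcat p q) r by [].
  by apply: qpath_eq; rewrite ?psrc_pcat ?parr_pcat ?catA.
- rewrite path_mul0l; apply: etrans (path_mulUU _ _ _ _) _.
  by rewrite /pmul (psrc_pcat qr) (negPf npq).
- refine (etrans (path_mul0r _) (etrans _ (esym (path_mulUU _ _ _ _)))).
  by rewrite /pmul (ptgt_pcat pq) (negPf nqr).
- exact: etrans (path_mul0r _) (esym (path_mul0l _)).
Qed.

Lemma path_mul1l : left_id path_alg_one mul.
Proof.
apply: (@path_alg_ind (mul path_alg_one) id) => [x y|//|c p].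
  exact: path_mulDr.
rewrite path_mul_suml (bigD1 (psrc p)) //= big1 ?addr0.
  rewrite path_mulUU /pmul eqxx mul1r.
  suff -> : pcat (ptriv (psrc p)) p = p by [].
  by apply: qpath_eq; rewrite ?psrc_pcat ?parr_pcat.
by move=> v /negPf nv; rewrite path_mulUU /pmul /= [_ == _]nv.
Qed.

Lemma path_mul1r : right_id path_alg_one mul.
Proof.
apply: (@path_alg_ind (mul^~ path_alg_one) id) => [x y|//|c p].
  exact: path_mulDl.
rewrite path_mul_sumr (bigD1 (ptgt p)) //= big1 ?addr0.
  rewrite path_mulUU /pmul eqxx mulr1.
  suff -> : pcat p (ptriv (ptgt p)) = p by [].
  by apply: qpath_eq; rewrite ?psrc_pcat ?parr_pcat ?cats0.
by move=> v nv; rewrite path_mulUU /pmul eq_sym [_ == _](negPf nv).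
Qed.

Definition path_alg : Type := kQ.
HB.instance Definition _ := GRing.Lmodule.on path_alg.
HB.instance Definition _ := GRing.Zmodule_isPzRing.Build path_alg
  path_mulA path_mul1l path_mul1r path_mulDl path_mulDr.

Definition path_elt (p : path) : path_alg := << p >>.
Definition arrow_elt (a : arrow Q) : path_alg := path_elt (parrow a).

(* The m-th power of the ideal generated by the arrows. *)
Definition arrow_ideal_pow (m : nat) : ideal path_alg :=
  ideal_gen (fun x : path_alg => exists2 p, plen p = m & x = path_elt p).

Definition admissible (I : ideal path_alg) : Prop :=
  exists2 m, (2 <= m)%N &
    (forall x, arrow_ideal_pow m x -> I x) /\
    (forall x, I x -> arrow_ideal_pow 2 x).

(* Finite-dimensionality of kQ/I is part of admissibility, Q being finite. *)
Definition gentle (I : ideal path_alg) : Prop :=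
  [/\ admissible I,
      forall v : vertex Q, (#|[set a : arrow Q | tgt a == v]| <= 2)%N
        /\ (#|[set a : arrow Q | src a == v]| <= 2)%N,
      forall a b c : arrow Q, a <> b -> tgt a = src c -> tgt b = src c ->
        (I (arrow_elt a * arrow_elt c) /\ ~ I (arrow_elt b * arrow_elt c)) \/
        (~ I (arrow_elt a * arrow_elt c) /\ I (arrow_elt b * arrow_elt c)),
      forall a b c : arrow Q, a <> b -> src a = tgt c -> src b = tgt c ->
        (I (arrow_elt c * arrow_elt a) /\ ~ I (arrow_elt c * arrow_elt b)) \/
        (~ I (arrow_elt c * arrow_elt a) /\ I (arrow_elt c * arrow_elt b)) &
      exists2 S : path -> Prop, (forall p, S p -> plen p = 2) &
        forall x, I x <->
          ideal_gen (fun y : path_alg => exists2 p, S p & y = path_elt p) x].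
End PathAlgebra.

(* Right R-modules are left modules over the converse ring: for m in such a
   module, the right action m.r is written (r *: m). *)
Notation rmod R := (lmodType R^c).

Definition regular_rmod (R : pzRingType) : rmod R := (R^c)^o.

Definition iso (R : pzRingType) (M N : lmodType R) : Prop :=
  exists f : {linear M -> N}, bijective f.

Definition zero_module (R : pzRingType) (M : lmodType R) : Prop :=
  forall x : M, x = 0.

Definition fingen (R : pzRingType) (M : lmodType R) : Prop :=
  exists n (g : 'I_n -> M), forall x, exists c : 'I_n -> R,
    x = \sum_i c i *: g i.

Definition projective (R : pzRingType) (P : lmodType R) : Prop :=
  forall (M N : lmodType R) (p : {linear M -> N}) (f : {linear P -> N}),
    (forall y, exists x, p x = y) ->
    exists g : {linear P -> M}, forall x, p (g x) = f x.

Definition indecomposable (R : pzRingType) (M : lmodType R) : Prop :=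
  ~ zero_module M /\
  forall X Y : lmodType R, iso M (X * Y)%type ->
    zero_module X \/ zero_module Y.

(* An exact complex ... -> P i -> P (i+1) -> ... of finitely generated
   projectives, indexed by all integers, whose R-dual is exact. *)
Definition totally_acyclic (R : pzRingType) (P : int -> rmod R)
    (d : forall i : int, {linear P i -> P (i + 1)}) : Prop :=
  [/\ forall i, fingen (P i),
      forall i, projective (P i),
      forall i (x : P (i + 1)), d (i + 1) x = 0 <-> exists y, d i y = x &
      forall i (f : {linear P (i + 1) -> regular_rmod R}),
        (forall x, f (d i x) = 0) <->
        exists g : {linear P (i + 1 + 1) -> regular_rmod R},
          forall x, g (d (i + 1) x) = f x].

Definition gorenstein_projective (R : pzRingType) (G : rmod R) : Prop :=
  exists (P : int -> rmod R) (d : forall i : int, {linear P i -> P (i + 1)}),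
    totally_acyclic d /\
    exists i (j : {linear G -> P (i + 1)}),
      injective j /\ forall y, (exists x, j x = y) <-> (exists z, d i z = y).

Section RightIdeal.
Variables (R : pzRingType) (e : R).

Definition right_ideal_pred (x : regular_rmod R) : bool := e * (x : R) == x.

Lemma right_ideal_closed : submod_closed right_ideal_pred.
Proof.
split=> [|a x y]; rewrite /in_mem /= /right_ideal_pred ?mulr0 //.
move=> /eqP ex /eqP ey; apply/eqP.
by rewrite mulrDr [e * (y : R)]ey; congr (_ + _); rewrite mulrA ex.
Qed.

HB.instance Definition _ := GRing.isSubmodClosed.Build R^c (regular_rmod R)
  right_ideal_pred right_ideal_closed.

(* The right ideal eR when e is idempotent. *)
Definition right_ideal : Type := {x : regular_rmod R | right_ideal_pred x}.
HB.instance Definition _ := SubChoice.on right_ideal.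
HB.instance Definition _ := [SubChoice_isSubLmodule of right_ideal by <:].

Definition right_ideal_rmod : rmod R := right_ideal.
End RightIdeal.

Lemma linear_ext (R : pzRingType) (U V : lmodType R) (f g : {linear U -> V}) :
  f =1 g -> f = g.
Proof.
case: f g => f [[[f0 fD]] [fZ]] [g [[[g0 gD]] [gZ]]] /= /funext fg.
move: g0 gD gZ; rewrite -fg => g0 gD gZ.
by rewrite (Prop_irrelevance f0 g0) (Prop_irrelevance fD gD)
  (Prop_irrelevance fZ gZ).
Qed.

Definition lhom (R : pzRingType) (U V : lmodType R) : Type := {linear U -> V}.
Definition lhom_fun (R : pzRingType) (U V : lmodType R) (f : lhom U V) :
  {linear U -> V} := f.
Coercion lhom_fun : lhom >-> GRing.Linear.type.

HB.instance Definition _ (R : pzRingType) (U V : lmodType R) :=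
  gen_eqMixin (lhom U V).
HB.instance Definition _ (R : pzRingType) (U V : lmodType R) :=
  gen_choiceMixin (lhom U V).

Section HomZmod.
Variables (R : pzRingType) (U V : lmodType R).
Implicit Types f g h : lhom U V.

Definition lhom0 : lhom U V := (\0 : U -> V) : {linear U -> V}.
Definition lhom_opp f : lhom U V := (\- f) : {linear U -> V}.
Definition lhom_add f g : lhom U V := (f \+ g) : {linear U -> V}.

Lemma lhom_addA : associative lhom_add.
Proof. by move=> f g h; apply: linear_ext => x /=; rewrite addrA. Qed.
Lemma lhom_addC : commutative lhom_add.
Proof. by move=> f g; apply: linear_ext => x /=; rewrite addrC. Qed.
Lemma lhom_add0 : left_id lhom0 lhom_add.
Proof. by move=> f; apply: linear_ext => x /=; rewrite add0r. Qed.
Lemma lhom_addN : left_inverse lhom0 lhom_opp lhom_add.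
Proof. by move=> f; apply: linear_ext => x /=; rewrite addNr. Qed.

HB.instance Definition _ := GRing.isZmodule.Build (lhom U V)
  lhom_addA lhom_addC lhom_add0 lhom_addN.
End HomZmod.

(* The product of [endo M] is composition: (f * g) x = f (g x). *)
Definition endo (R : pzRingType) (M : lmodType R) : Type := lhom M M.
Definition endo_fun (R : pzRingType) (M : lmodType R) (f : endo M) : lhom M M := f.
Coercion endo_fun : endo >-> lhom.
HB.instance Definition _ (R : pzRingType) (M : lmodType R) :=
  GRing.Zmodule.on (endo M).

Section EndoRing.
Variables (R : pzRingType) (M : lmodType R).
Implicit Types f g h : endo M.

Definition endo_one : endo M := (idfun : M -> M) : {linear M -> M}.
Definition endo_mul f g : endo M := (f \o g) : {linear M -> M}.

Lemma endo_mulA : associative endo_mul.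
Proof. by move=> f g h; apply: linear_ext. Qed.
Lemma endo_mul1l : left_id endo_one endo_mul.
Proof. by move=> f; apply: linear_ext. Qed.
Lemma endo_mul1r : right_id endo_one endo_mul.
Proof. by move=> f; apply: linear_ext. Qed.
Lemma endo_mulDl : left_distributive endo_mul +%R.
Proof. by move=> f g h; apply: linear_ext. Qed.
Lemma endo_mulDr : right_distributive endo_mul +%R.
Proof. by move=> h f g; apply: linear_ext => x; exact: raddfD. Qed.

HB.instance Definition _ := GRing.Zmodule_isPzRing.Build (endo M)
  endo_mulA endo_mul1l endo_mul1r endo_mulDl endo_mulDr.
End EndoRing.

(* An S-R-bimodule: a right R-module with a left action of S by R-linear maps. *)
Record bimod (S R : pzRingType) := Bimod {
  bimod_sort :> rmod R;
  lact : {rmorphism S -> endo bimod_sort} }.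

Record functor (R S : pzRingType) := Functor {
  fobj :> rmod R -> rmod S;
  fmap : forall M N : rmod R, {linear M -> N} -> {linear fobj M -> fobj N};
  fmap_id : forall (M : rmod R) x, fmap (idfun : {linear M -> M}) x = x;
  fmap_comp : forall (L M N : rmod R) (g : {linear M -> N}) (f : {linear L -> M}) x,
    fmap (g \o f : {linear L -> N}) x = fmap g (fmap f x);
  fmap_add : forall (M N : rmod R) (f g : {linear M -> N}) x,
    fmap (f \+ g : {linear M -> N}) x = fmap f x + fmap g x }.
Arguments fmap {R S} f {M N} _ : rename.

(* On Hom_R(B, N) the right S-action is (h.s)(b) = h(s b). *)
Definition bhom (S R : pzRingType) (B : bimod S R) (N : rmod R) : Type := lhom B N.
Definition bhom_fun (S R : pzRingType) (B : bimod S R) (N : rmod R)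
  (h : bhom B N) : lhom B N := h.
Coercion bhom_fun : bhom >-> lhom.
HB.instance Definition _ (S R : pzRingType) (B : bimod S R) (N : rmod R) :=
  GRing.Zmodule.on (bhom B N).

Section BhomModule.
Variables (S R : pzRingType) (B : bimod S R) (N : rmod R).

Definition bhom_scale (s : S^c) (h : bhom B N) : bhom B N :=
  (h \o (lact B s : endo B)) : {linear B -> N}.

Lemma bhom_scaleA s t h : bhom_scale s (bhom_scale t h) = bhom_scale (s * t) h.
Proof.
apply: linear_ext => x.
by have E := congr1 (fun f : endo B => h (f x)) (esym (rmorphM (lact B) t s)).
Qed.
Lemma bhom_scale1 : left_id 1 bhom_scale.
Proof.
move=> h; apply: linear_ext => x.
by have E := congr1 (fun f : endo B => h (f x)) (rmorph1 (lact B)).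
Qed.
Lemma bhom_scaleDr : right_distributive bhom_scale +%R.
Proof. by move=> s h h'; apply: linear_ext. Qed.
Lemma bhom_scaleDl h : {morph bhom_scale^~ h : s t / s + t}.
Proof.
move=> s t; apply: linear_ext => x.
have E := congr1 (fun f : endo B => h (f x)) (raddfD (lact B) s t).
by apply: etrans E _; exact: raddfD.
Qed.

HB.instance Definition _ := GRing.Zmodule_isLmodule.Build S^c (bhom B N)
  bhom_scaleA bhom_scale1 bhom_scaleDr bhom_scaleDl.
End BhomModule.

Section HomFunctor.
Variables (S R : pzRingType) (B : bimod S R).

Definition bhom_obj (N : rmod R) : rmod S := bhom B N.

Section Map.
Variables (M N : rmod R) (f : {linear M -> N}).
Definition bhom_map (h : bhom_obj M) : bhom_obj N := (f \o h) : {linear B -> N}.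
Lemma bhom_map_linear : linear bhom_map.
Proof. by move=> s h h'; apply: linear_ext => x; exact: linearD. Qed.
HB.instance Definition _ :=
  GRing.isLinear.Build S^c (bhom_obj M) (bhom_obj N) *:%R bhom_map bhom_map_linear.
End Map.

Lemma bhom_map_id (M : rmod R) x : bhom_map (idfun : {linear M -> M}) x = x.
Proof. exact: linear_ext. Qed.
Lemma bhom_map_comp (L M N : rmod R) (g : {linear M -> N}) (f : {linear L -> M}) x :
  bhom_map (g \o f : {linear L -> N}) x = bhom_map g (bhom_map f x).
Proof. exact: linear_ext. Qed.
Lemma bhom_map_add (M N : rmod R) (f g : {linear M -> N}) x :
  bhom_map (f \+ g : {linear M -> N}) x = bhom_map f x + bhom_map g x.
Proof. exact: linear_ext. Qed.

Definition hom_functor : functor R S :=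
  @Functor R S bhom_obj (fun M N f => bhom_map f)
    bhom_map_id bhom_map_comp bhom_map_add.
End HomFunctor.

(* M (x)_S B is the free abelian group on M x B modulo the balancing
   relations, with (m (x) b).r = m (x) (b.r). *)
Section FreeLift.
Variables (K : choiceType) (V : zmodType) (g : K -> V).

Definition free_lift (x : {malg int[K]}) : V := \sum_(i <- msupp x) g i *~ x@_i.

Lemma free_liftw (d : {fset K}) x : (msupp x `<=` d)%fset ->
  free_lift x = \sum_(i <- d) g i *~ x@_i.
Proof.
move=> le; rewrite /free_lift (big_fset_incl _ le) // => i _ /mcoeff_outdom ->.
by rewrite mulr0z.
Qed.

Lemma free_liftB : zmod_morphism free_lift.
Proof.
move=> x y.
rewrite (@free_liftw (msupp x `|` msupp y)%fset) ?msuppB_le //.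
rewrite (@free_liftw (msupp x `|` msupp y)%fset x) ?fsubsetUl //.
rewrite (@free_liftw (msupp x `|` msupp y)%fset y) ?fsubsetUr //.
rewrite -sumrB; apply: eq_bigr => i _.
by rewrite mcoeffB mulrzBr.
Qed.
HB.instance Definition _ :=
  GRing.isZmodMorphism.Build {malg int[K]} V free_lift free_liftB.

Lemma free_liftU i : free_lift << i >> = g i.
Proof.
rewrite (@free_liftw [fset i]%fset) ?msuppU_le // big_seq_fset1.
by rewrite mcoeffUU.
Qed.
End FreeLift.

Section Tensor.
Variables (S R : pzRingType) (M : rmod S) (B : bimod S R).
Local Notation free := {malg int[(M * B)%type]}.

Variant tensor_rel : free -> Prop :=
| TensorDl m m' b : tensor_rel (<< (m + m', b) >> - << (m, b) >> - << (m', b) >>)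
| TensorDr m b b' : tensor_rel (<< (m, b + b') >> - << (m, b) >> - << (m, b') >>)
| TensorA m s b :
    tensor_rel (<< ((s : S^c) *: m, b) >> - << (m, (lact B s : endo B) b) >>).

Definition tensor : Type := zquot (span_subgroup tensor_rel).
HB.instance Definition _ := GRing.Zmodule.on tensor.

Definition tpure (m : M) (b : B) : tensor :=
  zpi (span_subgroup tensor_rel) << (m, b) >>.

Definition balanced (V : zmodType) (g : M -> B -> V) : Prop :=
  [/\ forall m m' b, g (m + m') b = g m b + g m' b,
      forall m b b', g m (b + b') = g m b + g m b' &
      forall m s b, g ((s : S^c) *: m) b = g m ((lact B s : endo B) b)].

Lemma tpure_balanced : balanced tpure.
Proof.
split=> [m m' b|m b b'|m s b]; rewrite /tpure.
- rewrite -raddfD; apply/zpi_eq => P; apply; rewrite opprD addrA.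
  exact: TensorDl.
- rewrite -raddfD; apply/zpi_eq => P; apply; rewrite opprD addrA.
  exact: TensorDr.
- by apply/zpi_eq => P; apply; exact: TensorA.
Qed.

Lemma tensor_ext (V : zmodType) (f g : tensor -> V) :
  zmod_morphism f -> zmod_morphism g ->
  (forall m b, f (tpure m b) = g (tpure m b)) -> f =1 g.
Proof.
move=> fB gB fg u.
pose F : {additive tensor -> V} := HB.pack f (GRing.isZmodMorphism.Build _ _ f fB).
pose G : {additive tensor -> V} := HB.pack g (GRing.isZmodMorphism.Build _ _ g gB).
have tE x : zpi (span_subgroup tensor_rel) x =
    \sum_(i <- msupp x) tpure i.1 i.2 *~ x@_i.
  rewrite {1}[x]monalgE raddf_sum; apply: eq_bigr => -[m b] _.
  by rewrite /tpure -raddfMz -(raddfMz (mkmalgU (m, b))) intz.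
rewrite -[u]zreprK tE -[LHS]/(F _) -[RHS]/(G _) !raddf_sum.
by apply: eq_bigr => i _; rewrite (raddfMz F) (raddfMz G) [F _]fg.
Qed.

Section Lift.
Variables (V : zmodType) (g : M -> B -> V) (gP : balanced g).
Definition tlift (u : tensor) : V := free_lift (fun p => g p.1 p.2) (zrepr u).

Lemma free_lift_rel x : span_set tensor_rel x -> free_lift (fun p => g p.1 p.2) x = 0.
Proof.
have cl : subgroup_closed (fun x : free => free_lift (fun p => g p.1 p.2) x = 0).
  by split=> [|y z y0 z0]; rewrite ?raddf0 // raddfB /= y0 z0 subr0.
move=> /(_ (Subgroup cl)); apply => _ [] * /=; case: gP => g1 g2 g3.
- by rewrite !raddfB /= !free_liftU /= g1 addrAC addrK subrr.
- by rewrite !raddfB /= !free_liftU /= g2 addrAC addrK subrr.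
- by rewrite raddfB /= !free_liftU /= g3 subrr.
Qed.

Lemma tlift_zpi x :
  tlift (zpi (span_subgroup tensor_rel) x) = free_lift (fun p => g p.1 p.2) x.
Proof.
apply/eqP; rewrite /tlift -subr_eq0 -raddfB; apply/eqP; apply: free_lift_rel.
exact: (zreprP (span_subgroup tensor_rel) x).
Qed.

Lemma tliftB : zmod_morphism tlift.
Proof.
move=> u v; rewrite -[u]zreprK -[v]zreprK -raddfB !tlift_zpi.
by rewrite raddfB.
Qed.

Lemma tlift_pure m b : tlift (tpure m b) = g m b.
Proof. by rewrite tlift_zpi free_liftU. Qed.
End Lift.

Definition tensor_act (r : R^c) (m : M) (b : B) : tensor := tpure m (r *: b).

Lemma tensor_act_balanced r : balanced (tensor_act r).
Proof.
case: tpure_balanced => t1 t2 t3; split=> *; rewrite /tensor_act ?t1 //.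
  by rewrite scalerDr t2.
by rewrite t3 linearZ.
Qed.

Definition tensor_scale (r : R^c) : tensor -> tensor := tlift (tensor_act r).

Lemma tensor_scaleB r : zmod_morphism (tensor_scale r).
Proof. exact/tliftB/tensor_act_balanced. Qed.
HB.instance Definition _ r := GRing.isZmodMorphism.Build tensor tensor
  (tensor_scale r) (tensor_scaleB r).

Lemma tensor_scale_pure r m b : tensor_scale r (tpure m b) = tpure m (r *: b).
Proof. by rewrite /tensor_scale tlift_pure //; exact: tensor_act_balanced. Qed.

Lemma tensor_scaleA r s u :
  tensor_scale r (tensor_scale s u) = tensor_scale (r * s) u.
Proof.
move: u; apply: tensor_ext => [u v|u v|m b]; rewrite ?raddfB //.
by rewrite !tensor_scale_pure scalerA.
Qed.
Lemma tensor_scale1 : left_id 1 tensor_scale.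
Proof.
apply: tensor_ext => [u v|u v|m b]; rewrite ?raddfB //.
by rewrite tensor_scale_pure scale1r.
Qed.
Lemma tensor_scaleDr : right_distributive tensor_scale +%R.
Proof. by move=> r u v; rewrite raddfD. Qed.
Lemma tensor_scaleDl u : {morph tensor_scale^~ u : r s / r + s}.
Proof.
move=> r s; move: u; apply: tensor_ext => [u v|u v|m b]; rewrite ?raddfB //.
  by rewrite /= opprD addrACA.
by rewrite !tensor_scale_pure scalerDl; case: tpure_balanced.
Qed.

HB.instance Definition _ := GRing.Zmodule_isLmodule.Build R^c tensor
  tensor_scaleA tensor_scale1 tensor_scaleDr tensor_scaleDl.
End Tensor.

Section TensorFunctor.
Variables (S R : pzRingType) (B : bimod S R).

Definition tensor_obj (M : rmod S) : rmod R := tensor M B.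

Section Map.
Variables (M N : rmod S) (f : {linear M -> N}).

Definition tensor_arg (m : M) (b : B) : tensor N B := tpure (f m) b.

Lemma tensor_arg_balanced : balanced tensor_arg.
Proof.
have [t1 t2 t3] := tpure_balanced N B.
by split=> *; rewrite /tensor_arg ?raddfD ?linearZ ?t1 ?t2 ?t3.
Qed.

Definition tensor_map : tensor_obj M -> tensor_obj N := tlift tensor_arg.

Lemma tensor_map_zmod_morphism : zmod_morphism tensor_map.
Proof. exact/tliftB/tensor_arg_balanced. Qed.
HB.instance Definition _ := GRing.isZmodMorphism.Build
  (tensor_obj M) (tensor_obj N) tensor_map tensor_map_zmod_morphism.

Lemma tensor_map_pure m b : tensor_map (tpure m b) = tpure (f m) b.
Proof. by rewrite /tensor_map tlift_pure //; exact: tensor_arg_balanced. Qed.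

Lemma tensor_map_scalable : scalable tensor_map.
Proof.
move=> r; apply: tensor_ext => [u v|u v|m b].
- by rewrite scalerBr raddfB.
- by rewrite raddfB scalerBr.
- by rewrite [r *: _]tensor_scale_pure !tensor_map_pure [RHS]tensor_scale_pure.
Qed.
HB.instance Definition _ := GRing.isScalable.Build
  R^c (tensor_obj M) (tensor_obj N) *:%R tensor_map tensor_map_scalable.
End Map.

Lemma tensor_map_id (M : rmod S) x : tensor_map (idfun : {linear M -> M}) x = x.
Proof.
move: x; apply: tensor_ext => [u v|//|m b]; first by rewrite raddfB.
exact: tensor_map_pure.
Qed.
Lemma tensor_map_comp (L M N : rmod S) (g : {linear M -> N}) (f : {linear L -> M}) x :
  tensor_map (g \o f : {linear L -> N}) x = tensor_map g (tensor_map f x).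
Proof.
move: x; apply: tensor_ext => [u v|u v|m b]; rewrite ?raddfB //.
by rewrite !tensor_map_pure.
Qed.
Lemma tensor_map_add (M N : rmod S) (f g : {linear M -> N}) x :
  tensor_map (f \+ g : {linear M -> N}) x = tensor_map f x + tensor_map g x.
Proof.
move: x; apply: tensor_ext => [u v|u v|m b]; rewrite ?raddfB //.
  by rewrite /= opprD addrACA.
by rewrite !tensor_map_pure; case: (tpure_balanced N B) => ->.
Qed.

Definition tensor_functor : functor S R :=
  @Functor S R tensor_obj (fun M N f => tensor_map f)
    tensor_map_id tensor_map_comp tensor_map_add.
End TensorFunctor.

Definition inflation (R S : pzRingType) (f : {rmorphism R -> S}) (N : rmod S) :
  Type := N.
HB.instance Definition _ (R S : pzRingType) (f : {rmorphism R -> S}) (N : rmod S) :=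
  GRing.Zmodule.on (inflation f N).

Section Inflation.
Variables (R S : pzRingType) (f : {rmorphism R -> S}).

Section Module.
Variable N : rmod S.
Definition inflation_scale (r : R^c) (n : inflation f N) : inflation f N :=
  (f r : S^c) *: (n : N).

Lemma inflation_scaleA r s n :
  inflation_scale r (inflation_scale s n) = inflation_scale (r * s) n.
Proof. by rewrite /inflation_scale scalerA [f (r * s)](rmorphM f s r). Qed.
Lemma inflation_scale1 : left_id 1 inflation_scale.
Proof. by move=> n; rewrite /inflation_scale [f 1](rmorph1 f) [LHS]scale1r. Qed.
Lemma inflation_scaleDr : right_distributive inflation_scale +%R.
Proof. by move=> r m n; exact: scalerDr. Qed.
Lemma inflation_scaleDl n : {morph inflation_scale^~ n : r s / r + s}.
Proof. by move=> r s; rewrite /inflation_scale raddfD; exact: scalerDl. Qed.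

HB.instance Definition _ := GRing.Zmodule_isLmodule.Build R^c (inflation f N)
  inflation_scaleA inflation_scale1 inflation_scaleDr inflation_scaleDl.
End Module.

Definition inflation_obj (N : rmod S) : rmod R := inflation f N.

Section Map.
Variables (M N : rmod S) (h : {linear M -> N}).
Definition inflation_map : inflation_obj M -> inflation_obj N := h.
Lemma inflation_map_linear : linear inflation_map.
Proof. by move=> r x y; exact: (linearP h). Qed.
HB.instance Definition _ := GRing.isLinear.Build
  R^c (inflation_obj M) (inflation_obj N) *:%R inflation_map inflation_map_linear.
End Map.

Definition inflation_functor : functor S R :=
  @Functor S R inflation_obj (fun M N h => inflation_map h)
    (fun _ _ => erefl) (fun _ _ _ _ _ _ => erefl) (fun _ _ _ _ _ => erefl).
End Inflation.

(* A multiplicative map A -> C sending 1 to eps makes N.eps, for N a right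
   C-module, into a right A-module; it need not send 1 to 1. *)
Record corner (A C : pzRingType) (eps : C) := Corner {
  corner_map :> {additive A -> C};
  cornerM : forall a b, corner_map (a * b) = corner_map a * corner_map b;
  corner1 : corner_map 1 = eps }.

Lemma corner_mulr1 (A C : pzRingType) (eps : C) (f : corner A eps) a :
  f a * eps = f a.
Proof. by have := cornerM f a 1; rewrite mulr1 corner1. Qed.

Lemma corner_mul1r (A C : pzRingType) (eps : C) (f : corner A eps) a :
  eps * f a = f a.
Proof. by have := cornerM f 1 a; rewrite mul1r corner1. Qed.

Section Restriction.
Variables (A C : pzRingType) (eps : C) (f : corner A eps).

Section Module.
Variable N : rmod C.

Definition res_pred (n : N) : bool := (eps : C^c) *: n == n.

Lemma res_pred_closed : zmod_closed res_pred.
Proof.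
split=> [|x y]; rewrite /in_mem /= /res_pred ?scaler0 //.
by move=> /eqP ex /eqP ey; rewrite scalerBr ex ey.
Qed.
HB.instance Definition _ := GRing.isZmodClosed.Build N res_pred res_pred_closed.

Definition res : Type := {n : N | res_pred n}.
HB.instance Definition _ := SubChoice.on res.
HB.instance Definition _ := [SubChoice_isSubZmodule of res by <:].

Lemma res_scale_subproof (a : A) (n : res) : res_pred ((f a : C^c) *: val n).
Proof.
rewrite /res_pred scalerA; apply/eqP.
by have E := congr1 (fun c : C^c => c *: val n) (corner_mulr1 f a).
Qed.

Definition res_scale (a : A^c) (n : res) : res :=
  exist _ ((f a : C^c) *: val n) (res_scale_subproof a n).

Lemma res_scaleA a b n : res_scale a (res_scale b n) = res_scale (a * b) n.
Proof.
apply/val_inj => /=; rewrite scalerA.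
by have E := congr1 (fun c : C^c => c *: val n) (esym (cornerM f b a)).
Qed.
Lemma res_scale1 : left_id 1 res_scale.
Proof.
move=> n; apply/val_inj => /=; rewrite [f 1]corner1.
exact/eqP/(valP n).
Qed.
Lemma res_scaleDr : right_distributive res_scale +%R.
Proof. by move=> a m n; apply/val_inj; exact: scalerDr. Qed.
Lemma res_scaleDl n : {morph res_scale^~ n : a b / a + b}.
Proof.
by move=> a b; apply/val_inj; rewrite /= [f _]raddfD; exact: scalerDl.
Qed.

HB.instance Definition _ := GRing.Zmodule_isLmodule.Build A^c res
  res_scaleA res_scale1 res_scaleDr res_scaleDl.
End Module.

Definition res_obj (N : rmod C) : rmod A := res N.

Section Map.
Variables (M N : rmod C) (h : {linear M -> N}).

Lemma res_map_subproof (m : res M) : res_pred (h (val m)).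
Proof. by rewrite /res_pred -linearZ (eqP (valP m)). Qed.

Definition res_map (m : res_obj M) : res_obj N :=
  exist _ (h (val m)) (res_map_subproof m).
Lemma res_map_linear : linear res_map.
Proof. by move=> a x y; apply/val_inj; exact: linearP. Qed.
HB.instance Definition _ := GRing.isLinear.Build
  A^c (res_obj M) (res_obj N) *:%R res_map res_map_linear.
End Map.

Lemma res_map_id (M : rmod C) x : res_map (idfun : {linear M -> M}) x = x.
Proof. exact/val_inj. Qed.
Lemma res_map_comp (L M N : rmod C) (h : {linear M -> N}) (g : {linear L -> M}) x :
  res_map (h \o g : {linear L -> N}) x = res_map h (res_map g x).
Proof. exact/val_inj. Qed.
Lemma res_map_add (M N : rmod C) (h g : {linear M -> N}) x :
  res_map (h \+ g : {linear M -> N}) x = res_map h x + res_map g x.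
Proof. exact/val_inj. Qed.

Definition res_functor : functor C A :=
  @Functor C A res_obj (fun M N h => res_map h)
    res_map_id res_map_comp res_map_add.
End Restriction.

Section MkBimod.
Variables (S R : pzRingType) (B : rmod R) (act : S -> B -> B).
Hypotheses (actL : forall s, linear (act s))
  (actD : forall s t b, act (s + t) b = act s b + act t b)
  (act1 : forall b, act 1 b = b)
  (actM : forall s t b, act (s * t) b = act s (act t b)).

Definition mk_lact (s : S) : endo B :=
  HB.pack_for {linear B -> B} (act s) (GRing.isLinear.Build _ _ _ _ _ (actL s)).
Lemma mk_lactB : zmod_morphism mk_lact.
Proof.
move=> s t; apply: linear_ext => b.
by change (act (s - t) b = act s b - act t b); rewrite -{2}[s](subrK t) (actD (s - t)) addrK.
Qed.
Lemma mk_lactM : monoid_morphism mk_lact.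
Proof. by split=> [|s t]; apply: linear_ext => b; [exact: act1 | exact: actM]. Qed.
HB.instance Definition _ := GRing.isZmodMorphism.Build S (endo B) mk_lact mk_lactB.
HB.instance Definition _ := GRing.isMonoidMorphism.Build S (endo B) mk_lact mk_lactM.

Definition mk_bimod : bimod S R := @Bimod S R B mk_lact.
End MkBimod.

Section CornerBimodules.
Variables (A C : pzRingType) (eps : C) (f : corner A eps).

Lemma epsC_subproof (a : A) (x : right_ideal eps) :
  right_ideal_pred eps (f a * (val x : C)).
Proof. by rewrite /right_ideal_pred mulrA corner_mul1r. Qed.

Definition epsC_act (a : A) (x : right_ideal_rmod eps) : right_ideal_rmod eps :=
  exist _ (f a * (val x : C)) (epsC_subproof a x).

Lemma epsC_act_linear a : linear (epsC_act a).
Proof.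
move=> c x y; apply/val_inj => /=; rewrite mulrDr; congr (_ + _).
by have E := mulrA (f a) (val x : C) (c : C).
Qed.
Lemma epsC_actD a b x : epsC_act (a + b) x = epsC_act a x + epsC_act b x.
Proof. by apply/val_inj; rewrite /= raddfD mulrDl. Qed.
Lemma epsC_act1 x : epsC_act 1 x = x.
Proof. by apply/val_inj; rewrite /= corner1; exact/eqP/(valP x). Qed.
Lemma epsC_actM a b x : epsC_act (a * b) x = epsC_act a (epsC_act b x).
Proof. by apply/val_inj; rewrite /= cornerM mulrA. Qed.

Definition epsC : bimod A C :=
  mk_bimod epsC_act_linear epsC_actD epsC_act1 epsC_actM.

(* C eps is the restriction of the right module C. *)
Lemma Ceps_subproof (c : C) (x : res eps (regular_rmod C)) :
  res_pred eps (c * (val x : C) : regular_rmod C).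
Proof.
by rewrite /res_pred; change (c * (val x : C) * eps == c * (val x : C));
  rewrite -mulrA [_ * eps](eqP (valP x)).
Qed.

Definition Ceps_act (c : C) (x : res_obj f (regular_rmod C)) :
    res_obj f (regular_rmod C) :=
  exist _ (c * (val x : C) : regular_rmod C) (Ceps_subproof c x).

Lemma Ceps_act_linear c : linear (Ceps_act c).
Proof.
move=> a x y; apply/val_inj => /=; rewrite mulrDr; congr (_ + _).
by have E := mulrA c (val x : C) (f a).
Qed.
Lemma Ceps_actD c d x : Ceps_act (c + d) x = Ceps_act c x + Ceps_act d x.
Proof. by apply/val_inj; rewrite /= mulrDl. Qed.
Lemma Ceps_act1 x : Ceps_act 1 x = x.
Proof. by apply/val_inj; rewrite /= mul1r. Qed.
Lemma Ceps_actM c d x : Ceps_act (c * d) x = Ceps_act c (Ceps_act d x).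
Proof. by apply/val_inj; rewrite /= mulrA. Qed.

Definition Ceps : bimod C A :=
  mk_bimod Ceps_act_linear Ceps_actD Ceps_act1 Ceps_actM.
End CornerBimodules.

Section QuotientBimodules.
Variables (C : pzRingType) (I : ideal C).
Local Notation B := (rquot I).

Definition quot_act (c : C) (x : regular_rmod B) : regular_rmod B :=
  rpi I c * (x : B).
Lemma quot_act_linear c : linear (quot_act c).
Proof.
move=> b x y; rewrite /quot_act mulrDr; congr (_ + _).
by have E := mulrA (rpi I c) (x : B) (b : B).
Qed.
Lemma quot_actD c d x : quot_act (c + d) x = quot_act c x + quot_act d x.
Proof. by rewrite /quot_act raddfD mulrDl. Qed.
Lemma quot_act1 x : quot_act 1 x = x.
Proof. by rewrite /quot_act rmorph1 mul1r. Qed.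
Lemma quot_actM c d x : quot_act (c * d) x = quot_act c (quot_act d x).
Proof. by rewrite /quot_act rmorphM mulrA. Qed.

Definition quot_bimodl : bimod C B :=
  mk_bimod quot_act_linear quot_actD quot_act1 quot_actM.

Definition quot_lmul (b : B) (x : inflation_obj (rpi I) (regular_rmod B)) :
  inflation_obj (rpi I) (regular_rmod B) := b * (x : B).
Lemma quot_lmul_linear b : linear (quot_lmul b).
Proof.
move=> c x y; rewrite /quot_lmul mulrDr; congr (_ + _).
by have E := mulrA b (x : B) (rpi I c).
Qed.
Lemma quot_lmulD b c x : quot_lmul (b + c) x = quot_lmul b x + quot_lmul c x.
Proof. by rewrite /quot_lmul mulrDl. Qed.
Lemma quot_lmul1 x : quot_lmul 1 x = x.
Proof. by have E := mul1r (x : B). Qed.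
Lemma quot_lmulM b c x : quot_lmul (b * c) x = quot_lmul b (quot_lmul c x).
Proof. by rewrite /quot_lmul mulrA. Qed.

Definition quot_bimodr : bimod B C :=
  mk_bimod quot_lmul_linear quot_lmulD quot_lmul1 quot_lmulM.
End QuotientBimodules.

Definition preserves_fingen (R S : pzRingType) (F : functor R S) : Prop :=
  forall M : rmod R, fingen M -> fingen (F M).

(* F is left adjoint to G, between finitely generated modules. *)
Definition adjoint (R S : pzRingType) (F : functor R S) (G : functor S R) : Prop :=
  exists Phi : forall (X : rmod R) (Y : rmod S), {linear F X -> Y} -> {linear X -> G Y},
    (forall X Y, fingen X -> fingen Y -> bijective (Phi X Y)) /\
    (forall (X X' : rmod R) (Y Y' : rmod S) (a : {linear X' -> X})
        (b : {linear Y -> Y'}) (h : {linear F X -> Y}) x,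
      fingen X -> fingen X' -> fingen Y -> fingen Y' ->
      Phi X' Y' (b \o h \o fmap F a : {linear F X' -> Y'}) x =
      fmap G b (Phi X Y h (a x))).

Definition fully_faithful (R S : pzRingType) (F : functor R S) : Prop :=
  forall M N : rmod R, fingen M -> fingen N ->
    bijective (fun f : {linear M -> N} => fmap F f).

(*            <-- q --             <-- l --
     mod(R')  --- i -->  mod(R)   --- e -->  mod(R'')
              <-- p --             <-- r --           *)
Definition recollement (R' R R'' : pzRingType)
    (q : functor R R') (i : functor R' R) (p : functor R R')
    (l : functor R'' R) (e : functor R R'') (r : functor R'' R) : Prop :=
  [/\ [/\ preserves_fingen q, preserves_fingen i & preserves_fingen p],
      [/\ preserves_fingen l, preserves_fingen e & preserves_fingen r],
      [/\ adjoint q i, adjoint i p, adjoint l e & adjoint e r],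
      [/\ fully_faithful i, fully_faithful l & fully_faithful r] &
      forall N : rmod R, fingen N ->
        zero_module (e N) <-> exists2 M : rmod R', fingen M & iso N (i M)].

Definition standard_recollement (A C : pzRingType) (eps : C) (f : corner A eps) :
    Prop :=
  let I := ideal_gen (fun x : C => x = eps) in
  recollement
    (tensor_functor (quot_bimodl I)) (inflation_functor (rpi I))
    (hom_functor (quot_bimodr I))
    (tensor_functor (epsC f)) (res_functor f) (hom_functor (Ceps f)).

Definition dsum (R : pzRingType) (I : finType) (X : I -> rmod R) : Type :=
  forall i, X i.
HB.instance Definition _ (R : pzRingType) (I : finType) (X : I -> rmod R) :=
  gen_eqMixin (dsum X).
HB.instance Definition _ (R : pzRingType) (I : finType) (X : I -> rmod R) :=
  gen_choiceMixin (dsum X).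

Section DirectSum.
Variables (R : pzRingType) (I : finType) (X : I -> rmod R).
Implicit Types m n : dsum X.

Lemma dsum_ext m n : (forall i, m i = n i) -> m = n.
Proof. exact: functional_extensionality_dep. Qed.

Definition dsum0 : dsum X := fun i => 0.
Definition dsum_opp m : dsum X := fun i => - m i.
Definition dsum_add m n : dsum X := fun i => m i + n i.
Definition dsum_scale (r : R^c) m : dsum X := fun i => r *: m i.

Lemma dsum_addA : associative dsum_add.
Proof. by move=> l m n; apply: dsum_ext => i; apply: addrA. Qed.
Lemma dsum_addC : commutative dsum_add.
Proof. by move=> m n; apply: dsum_ext => i; apply: addrC. Qed.
Lemma dsum_add0 : left_id dsum0 dsum_add.
Proof. by move=> m; apply: dsum_ext => i; apply: add0r. Qed.
Lemma dsum_addN : left_inverse dsum0 dsum_opp dsum_add.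
Proof. by move=> m; apply: dsum_ext => i; apply: addNr. Qed.
HB.instance Definition _ := GRing.isZmodule.Build (dsum X)
  dsum_addA dsum_addC dsum_add0 dsum_addN.

Lemma dsum_scaleA r s m : dsum_scale r (dsum_scale s m) = dsum_scale (r * s) m.
Proof. by apply: dsum_ext => i; apply: scalerA. Qed.
Lemma dsum_scale1 : left_id 1 dsum_scale.
Proof. by move=> m; apply: dsum_ext => i; apply: scale1r. Qed.
Lemma dsum_scaleDr : right_distributive dsum_scale +%R.
Proof. by move=> r m n; apply: dsum_ext => i; apply: scalerDr. Qed.
Lemma dsum_scaleDl m : {morph dsum_scale^~ m : r s / r + s}.
Proof. by move=> r s; apply: dsum_ext => i; apply: scalerDl. Qed.
HB.instance Definition _ := GRing.Zmodule_isLmodule.Build R^c (dsum X)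
  dsum_scaleA dsum_scale1 dsum_scaleDr dsum_scaleDl.

Definition dsum_proj (i : I) (m : dsum X) : dsum X :=
  fun j => if j == i then m j else 0.
Lemma dsum_proj_linear i : linear (dsum_proj i).
Proof.
move=> r m n; apply: dsum_ext => j.
change (dsum_proj i (r *: m + n) j = r *: dsum_proj i m j + dsum_proj i n j).
by rewrite /dsum_proj; case: (j == i); rewrite // scaler0 addr0.
Qed.
HB.instance Definition _ i := GRing.isLinear.Build
  R^c (dsum X) (dsum X) *:%R (dsum_proj i) (dsum_proj_linear i).
End DirectSum.

(* A complete family of orthogonal idempotents. *)
Record cidem (A : pzRingType) (V : finType) := Cidem {
  cidem_elt :> V -> A;
  cidemM : forall v w, cidem_elt v * cidem_elt w = if v == w then cidem_elt v else 0;
  cidem1 : \sum_v cidem_elt v = 1 }.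

Section CMA.
Variables (A : pzRingType) (V : finType) (e : cidem A V).
Variables (J : finType) (G : J -> rmod A).

Definition gp_family (i : V + J) : rmod A :=
  match i with inl v => right_ideal_rmod (e v) | inr j => G j end.

(* The modules e_v A and G_j form a complete irredundant list of the
   indecomposable Gorenstein-projective A-modules. *)
Definition gp_complete : Prop :=
  [/\ forall i, indecomposable (gp_family i) /\ gorenstein_projective (gp_family i),
      forall i j, iso (gp_family i) (gp_family j) -> i = j &
      forall X : rmod A, indecomposable X -> gorenstein_projective X ->
        exists i, iso X (gp_family i)].

(* With right modules and the usual composition no opposite ring is needed:
   A = End_A(A) acts on itself by left multiplication, and e_i CMA is
   Hom_A(dsum gp_family, gp_family i). *)
Definition CMA : Type := endo (dsum gp_family).
HB.instance Definition _ := GRing.PzRing.on CMA.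

Definition cma_idem (i : V + J) : CMA :=
  (dsum_proj i : dsum gp_family -> dsum gp_family)
    : {linear dsum gp_family -> dsum gp_family}.

Definition cma_eps : CMA := \sum_(v : V) cma_idem (inl v).

(* A is the direct sum of the e_v A; an element a of A acts on it by left
   multiplication, and by zero on the other summands. *)
Definition cma_total (m : dsum gp_family) : A :=
  \sum_(v : V) (val (m (inl v) : right_ideal (e v)) : A).

Lemma cma_left_subproof (v : V) (x : A) : right_ideal_pred (e v) (e v * x).
Proof. by rewrite /right_ideal_pred mulrA cidemM eqxx. Qed.

Definition cma_left (a : A) (m : dsum gp_family) : dsum gp_family :=
  fun i => match i return gp_family i with
    | inl v => exist _ (e v * (a * cma_total m)) (cma_left_subproof v _)
    | inr j => 0
    end.

Lemma cma_total_linear c m n :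
  cma_total (c *: m + n) = cma_total m * (c : A) + cma_total n.
Proof. by rewrite mulr_suml -big_split. Qed.

Lemma cma_left_linear a : linear (cma_left a).
Proof.
move=> c m n; apply: dsum_ext => -[v|j].
  apply/val_inj.
  change (e v * (a * cma_total (c *: m + n)) =
    e v * (a * cma_total m) * (c : A) + e v * (a * cma_total n)).
  by rewrite cma_total_linear !mulrDr !mulrA.
by change (0 = c *: (0 : G j) + 0); rewrite scaler0 addr0.
Qed.

Definition cma_map (a : A) : CMA :=
  HB.pack_for {linear dsum gp_family -> dsum gp_family} (cma_left a)
    (GRing.isLinear.Build _ _ _ _ _ (cma_left_linear a)).

Lemma cma_mapB : zmod_morphism cma_map.
Proof.
move=> a b; apply: linear_ext => m; apply: dsum_ext => -[v|j].
  apply/val_inj.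
  change (e v * ((a - b) * cma_total m) =
    e v * (a * cma_total m) - e v * (b * cma_total m)).
  by rewrite mulrBl mulrBr.
by change (0 = (0 : G j) - 0); rewrite subr0.
Qed.
HB.instance Definition _ := GRing.isZmodMorphism.Build A CMA cma_map cma_mapB.

Lemma cma_total_left a m : cma_total (cma_left a m) = a * cma_total m.
Proof.
transitivity (\sum_v e v * (a * cma_total m)); first exact: eq_bigr.
by rewrite -mulr_suml cidem1 mul1r.
Qed.

Lemma cma_mapM a b : cma_map (a * b) = cma_map a * cma_map b.
Proof.
apply: linear_ext => m; apply: dsum_ext => -[v|j]; last by [].
apply/val_inj; change (e v * (a * b * cma_total m) =
  e v * (a * cma_total (cma_left b m))).
by rewrite cma_total_left (mulrA a).
Qed.

Lemma cma_map1 : cma_map 1 = cma_eps.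
Proof.
apply: linear_ext => m; apply: dsum_ext => i.
have -> : (cma_eps : CMA) m i = \sum_v dsum_proj (inl v) m i.
  rewrite /cma_eps; elim/big_rec2: _ => [|v y f _ <-]; first by [].
  by [].
case: i => [v|j].
  rewrite (bigD1 v) //= big1 ?addr0; last first.
    move=> w wv; rewrite /dsum_proj; case: eqP => // -[vw].
    by rewrite vw eqxx in wv.
  rewrite /dsum_proj eqxx; apply/val_inj.
  change (e v * (1 * cma_total m) = (val (m (inl v) : right_ideal (e v)) : A)).
  rewrite mul1r mulr_sumr (bigD1 v) //= big1 ?addr0.
    exact/eqP/(valP (m (inl v) : right_ideal (e v))).
  move=> w wv; rewrite -[X in e v * X](eqP (valP (m (inl w) : right_ideal (e w)))).
  by rewrite mulrA cidemM eq_sym (negPf wv) mul0r.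
by rewrite big1.
Qed.

(* The identification of A with eps C eps. *)
Definition cma_corner : corner A cma_eps :=
  @Corner A CMA cma_eps cma_map cma_mapM cma_map1.
End CMA.

Section VertexIdempotents.
Variables (k : fieldType) (Q : quiver) (I : ideal (path_alg k Q)).

Definition vertex_idem (v : vertex Q) : rquot I :=
  rpi I (path_elt k (ptriv v)).

Lemma vertex_idemM v w :
  vertex_idem v * vertex_idem w = if v == w then vertex_idem v else 0.
Proof.
rewrite /vertex_idem -rmorphM.
have -> : path_elt k (ptriv v) * path_elt k (ptriv w) =
    if v == w then path_elt k (ptriv v) else 0.
  apply: etrans (path_mulUU _ _ _ _) _; rewrite /pmul mulr1.
  change ((if v == w then << pcat (ptriv v) (ptriv w) >> else 0) =
    if v == w then << ptriv v >> else 0 :> {malg k[qpath Q]}).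
  have [->|//] := eqVneq v w.
  suff -> : pcat (ptriv w) (ptriv w) = ptriv w by [].
  by apply: qpath_eq; rewrite ?psrc_pcat ?parr_pcat.
by case: (v == w) => //; exact: raddf0.
Qed.

Lemma vertex_idem1 : \sum_v vertex_idem v = 1.
Proof. by rewrite -raddf_sum; exact: (rmorph1 (rpi I)). Qed.

Definition vertex_cidem : cidem (rquot I) (vertex Q) :=
  Cidem vertex_idemM vertex_idem1.
End VertexIdempotents.

(* Main.v *)
Require Import Defs.
From HB Require Import structures.
From mathcomp Require Import all_boot all_algebra.
From mathcomp Require Import boolp finmap monalg.

(** Write M for the direct sum of the e_v A and the G j, so that C = End(M) and
    eps C = Hom(M, A).  The recollement holds for every corner A = eps C eps; finite
    dimension over k is only needed for the functors to preserve finite generation.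
    The restriction of e_v C is Hom(A, M_v) = M_v.

    For the third claim, let X be a nonprojective Gorenstein-projective A-module and
    take 0 -> H -> P -> X -> 0 with P projective and H Gorenstein-projective.  Then H is
    not projective, and (as summands of Gorenstein-projectives are again
    Gorenstein-projective) it has a summand isomorphic to a nonprojective M_i.  A
    functional X (x) eps C -> C sees an element only through its image in Hom(M, X),
    so X (x) eps C would embed in Hom(M, X) if it were torsionless.
    But the kernel of X (x) Hom(M_i, A) -> Hom(M_i, X) consists of the maps M_i -> H
    modulo those that factor through a projective, and the inclusion of M_i in H
    represents a nonzero class.  Hence X (x) eps C is not even torsionless. *)

Set Implicit Arguments.
Unset Strict Implicit.
Unset Printing Implicit Defensive.

Import GRing.Theory.
Local Open Scope ring_scope.

(** * Linear maps and finitely generated modules *)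

(** The passage to summands is the main obstacle: a totally acyclic complex through G does not
    visibly split along a decomposition of G, and the infinite sums that would absorb a complement
    are not finitely generated. Complexes are therefore cut into short exact sequences 0 -> X -> P
    -> Y -> 0 along which functionals on X extend to P, and a two-sided chain is built afresh
    through the summand, one syzygy or cosyzygy at a time. Each new module is again a summand of a
    term of the old chain, up to a projective. The step to the right needs a map from X to a
    finitely generated projective along which every functional on X extends; finite dimension of
    Hom(X, R) provides it.

    Testing torsionlessness over C avoids any complex over C: a functional h on X (x) eps C is
    governed by the values h(x (x) eps), since h(x (x) b) = h(x (x) eps) b. What remains is a
    computation over A, where a finite dual basis of P writes down an explicit element of the
    kernel. *)

Lemma inj_surj_bij (T U : Type) (f : T -> U) :
  injective f -> (forall y, exists x, f x = y) -> bijective f.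
Proof.
move=> fI /choice[g fg]; exists g => // x.
by apply: fI; rewrite fg.
Qed.

Section LinearMaps.
Variables (S : pzRingType).
Implicit Types U V W : lmodType S.

Definition mklin U V (f : U -> V) (fL : linear f) : {linear U -> V} :=
  HB.pack_for {linear U -> V} f (GRing.isLinear.Build _ _ _ _ _ fL).

Lemma lin_pair_linear U V W (f : {linear U -> V}) (g : {linear U -> W}) :
  linear (fun x => (f x, g x) : (V * W)%type).
Proof. by move=> s x y; rewrite !linearP. Qed.
Definition lin_pair U V W (f : {linear U -> V}) (g : {linear U -> W}) :
  {linear U -> (V * W)%type} := mklin (lin_pair_linear f g).

Lemma lin_copair_linear U V W (f : {linear U -> W}) (g : {linear V -> W}) :
  linear (fun x : (U * V)%type => f x.1 + g x.2).
Proof. by move=> s x y; rewrite !linearP /= scalerDr addrACA. Qed.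
Definition lin_copair U V W (f : {linear U -> W}) (g : {linear V -> W}) :
  {linear (U * V)%type -> W} := mklin (lin_copair_linear f g).

Lemma lin_inl_linear U V : linear (fun x : U => (x, 0) : (U * V)%type).
Proof. by move=> s x y; apply: injective_projections; rewrite /= ?scaler0 ?addr0. Qed.
Definition lin_inl U V : {linear U -> (U * V)%type} := mklin (@lin_inl_linear U V).

Lemma lin_inr_linear U V : linear (fun y : V => (0, y) : (U * V)%type).
Proof. by move=> s x y; apply: injective_projections; rewrite /= ?scaler0 ?addr0. Qed.
Definition lin_inr U V : {linear V -> (U * V)%type} := mklin (@lin_inr_linear U V).

Lemma pairE U V (x : (U * V)%type) : x = lin_inl U V x.1 + lin_inr U V x.2.
Proof. by apply: injective_projections; rewrite /= ?addr0 ?add0r. Qed.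

Lemma inv_linear U V (f : {linear U -> V}) g : cancel f g -> cancel g f -> linear g.
Proof. by move=> fK gK s x y; apply: (can_inj fK); rewrite linearP !gK. Qed.

Lemma iso_sym U V : iso U V -> iso V U.
Proof.
case=> f [g fK gK]; exists (mklin (inv_linear fK gK)).
by exists f.
Qed.

Lemma iso_refl U : iso U U.
Proof. by exists (idfun : {linear U -> U}); exists id. Qed.

Section Kernel.
Variables (U V : lmodType S) (f : {linear U -> V}).
Definition mker_pred (x : U) : bool := f x == 0.
Lemma mker_closed : submod_closed mker_pred.
Proof.
split=> [|s x y]; rewrite /in_mem /= /mker_pred ?raddf0 //.
by move=> /eqP fx /eqP fy; rewrite linearP fx fy scaler0 addr0.
Qed.
HB.instance Definition _ := GRing.isSubmodClosed.Build S U mker_pred mker_closed.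
Definition mker : Type := {x : U | mker_pred x}.
HB.instance Definition _ := SubChoice.on mker.
HB.instance Definition _ := [SubChoice_isSubLmodule of mker by <:].

Definition mkerval : {linear mker -> U} := val.
Lemma mkerval_inj : injective mkerval. Proof. exact: val_inj. Qed.
Lemma mkervalP (x : mker) : f (mkerval x) = 0. Proof. exact/eqP/(valP x). Qed.

Lemma mker_lift W (g : {linear W -> U}) : (forall x, f (g x) = 0) ->
  exists h : {linear W -> mker}, forall x, mkerval (h x) = g x.
Proof.
move=> fg; pose h x : mker := exist _ (g x) (introT eqP (fg x)).
have hL : linear h by move=> s x y; apply/val_inj; exact: linearP.
by exists (mklin hL).
Qed.

Lemma mker_elt x : f x = 0 -> exists y, mkerval y = x.
Proof. by move=> fx; exists (exist _ x (introT eqP fx)). Qed.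
End Kernel.

Section Cokernel.
Variables (U V : lmodType S) (f : {linear U -> V}).
Lemma image_closed : subgroup_closed (fun y => exists x, f x = y).
Proof.
by split=> [|_ _ [x <-] [y <-]]; [exists 0; rewrite raddf0 | exists (x - y); rewrite raddfB].
Qed.
Definition image_subgroup := Subgroup image_closed.
Definition lcok : Type := zquot image_subgroup.
HB.instance Definition _ := GRing.Zmodule.on lcok.

Definition lcok_scale (s : S) (u : lcok) : lcok := zpi image_subgroup (s *: zrepr u).
Lemma lcok_scale_pi s x : lcok_scale s (zpi image_subgroup x) = zpi image_subgroup (s *: x).
Proof.
apply/zpi_eq; rewrite -scalerBr; case: (zreprP image_subgroup x) => y <-.
by exists (s *: y); rewrite linearZ.
Qed.
Lemma lcok_scaleA s t u : lcok_scale s (lcok_scale t u) = lcok_scale (s * t) u.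
Proof. by rewrite -[u]zreprK !lcok_scale_pi scalerA. Qed.
Lemma lcok_scale1 : left_id 1 lcok_scale.
Proof. by move=> u; rewrite -[u]zreprK !lcok_scale_pi scale1r. Qed.
Lemma lcok_scaleDr : right_distributive lcok_scale +%R.
Proof.
by move=> s u v; rewrite -[u]zreprK -[v]zreprK -raddfD !lcok_scale_pi scalerDr raddfD.
Qed.
Lemma lcok_scaleDl u : {morph lcok_scale^~ u : s t / s + t}.
Proof. by move=> s t; rewrite -[u]zreprK !lcok_scale_pi scalerDl raddfD. Qed.
HB.instance Definition _ := GRing.Zmodule_isLmodule.Build S lcok
  lcok_scaleA lcok_scale1 lcok_scaleDr lcok_scaleDl.

Lemma lcokpi_linear : linear (zpi image_subgroup : V -> lcok).
Proof.
by move=> s x y; rewrite raddfD; congr (_ + _); apply: esym (lcok_scale_pi s x).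
Qed.
Definition lcokpi : {linear V -> lcok} := mklin lcokpi_linear.
Lemma lcokpi_surj u : exists x, lcokpi x = u.
Proof. by exists (zrepr u); exact: zreprK. Qed.
Lemma lcokpi_eq0 x : lcokpi x = 0 <-> exists y, f y = x.
Proof. exact: (zpi_eq0 image_subgroup x). Qed.
End Cokernel.

Lemma factor_surj U V W (b : {linear U -> V}) (g : {linear U -> W}) :
  (forall y, exists x, b x = y) -> (forall x, b x = 0 -> g x = 0) ->
  exists h : {linear V -> W}, forall x, h (b x) = g x.
Proof.
move=> /choice[c cK] bg.
have E x : g (c (b x)) = g x.
  by apply: subr0_eq; rewrite -raddfB; apply: bg; rewrite raddfB /= cK subrr.
have hL : linear (g \o c).
  by move=> s x y; rewrite /= -linearP -[RHS]E linearP !cK.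
by exists (mklin hL).
Qed.

Lemma factor_inj U V W (a : {linear U -> V}) (g : {linear W -> V}) :
  injective a -> (forall x, exists y, a y = g x) ->
  exists h : {linear W -> U}, forall x, a (h x) = g x.
Proof.
move=> aI /choice[h hE].
have hL : linear h by move=> s x y; apply: aI; rewrite linearP !hE linearP.
by exists (mklin hL).
Qed.
End LinearMaps.

(** * Finitely generated, free and projective modules *)

Section FinitelyGenerated.
Variable (S : pzRingType).
Implicit Types U V W P X Y : lmodType S.

Lemma fingen_surj U V (f : {linear U -> V}) :
  (forall y, exists x, f x = y) -> fingen U -> fingen V.
Proof.
move=> fS [n [g gE]]; exists n, (f \o g) => y.
have [x <-] := fS y; have [c ->] := gE x; exists c.
by rewrite linear_sum; apply: eq_bigr => i _; rewrite linearZ.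
Qed.

Lemma fingen_prod U V : fingen U -> fingen V -> fingen (U * V)%type.
Proof.
move=> [m [g gE]] [n [h hE]].
have El i : split (lshift n i) = inl i by exact: unsplitK (inl i).
have Er i : split (rshift m i) = inr i by exact: unsplitK (inr i).
pose G i := match split i with inl j => lin_inl U V (g j) | inr j => lin_inr U V (h j) end.
exists (m + n)%N, G => x; have [c cE] := gE x.1; have [d dE] := hE x.2.
exists (fun i => match split i with inl j => c j | inr j => d j end).
rewrite [x]pairE cE dE !linear_sum big_split_ord /G.
by congr (_ + _); apply: eq_bigr => i _; rewrite ?El ?Er linearZ.
Qed.

Lemma fingen_fin U (T : finType) (g : T -> U) :
  (forall x, exists c : T -> S, x = \sum_i c i *: g i) -> fingen U.
Proof.
move=> gE; exists #|T|, (g \o enum_val) => x; have [c ->] := gE x.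
exists (c \o enum_val).
exact: (reindex _ (onW_bij _ (@enum_val_bij T))).
Qed.

Definition free_mod n : lmodType S := {ffun 'I_n -> S^o}.

Lemma regular_fingen : fingen (S^o : lmodType S).
Proof. by exists 1%N, (fun=> 1) => x; exists (fun=> x); rewrite big_ord1 [RHS]mulr1. Qed.

Lemma free_lift_linear n U (g : 'I_n -> U) :
  linear (fun x : free_mod n => \sum_i (x i : S) *: g i).
Proof.
move=> s x y; rewrite scaler_sumr -big_split; apply: eq_bigr => i _ /=.
by rewrite !ffunE scalerDl scalerA.
Qed.
Definition free_map n U (g : 'I_n -> U) : {linear free_mod n -> U} :=
  mklin (free_lift_linear g).

Definition delta n (i : 'I_n) : free_mod n := [ffun j => if j == i then 1 else 0].
Lemma free_basis n (x : free_mod n) : x = \sum_i (x i : S) *: delta i.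
Proof.
apply/ffunP => j; rewrite sum_ffunE (bigD1 j) //= !ffunE eqxx [_ *: _]mulr1.
by rewrite big1 ?addr0 // => i /negPf ij; rewrite !ffunE eq_sym ij scaler0.
Qed.

Lemma free_fingen n : fingen (free_mod n).
Proof. by exists n, (@delta n) => x; exists x; exact: free_basis. Qed.

Lemma free_projective n : projective (free_mod n).
Proof.
move=> M N p f pS; have /choice[m mE] i := pS (f (delta i)).
exists (free_map m) => x; rewrite [in RHS](free_basis x) !linear_sum.
by apply: eq_bigr => i _; rewrite !linearZ /= mE.
Qed.

Lemma fingen_cover U : fingen U ->
  exists n (f : {linear free_mod n -> U}), forall y, exists x, f x = y.
Proof.
move=> [n [g gE]]; exists n, (free_map g) => y; have [c ->] := gE y.
by exists (finfun c); apply: eq_bigr => i _; rewrite ffunE.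
Qed.

Definition fgproj P := fingen P /\ projective P.

Lemma free_fgproj n : fgproj (free_mod n).
Proof. by split; [exact: free_fingen | exact: free_projective]. Qed.

Lemma projective_prod P Q : projective P -> projective Q -> projective (P * Q)%type.
Proof.
move=> Pp Qp M N p f pS.
have [g gE] := Pp _ _ p (f \o lin_inl P Q : {linear P -> N}) pS.
have [h hE] := Qp _ _ p (f \o lin_inr P Q : {linear Q -> N}) pS.
exists (lin_copair g h) => x; rewrite [in RHS](pairE x) [RHS]raddfD.
by rewrite [LHS]raddfD; congr (_ + _); [exact: gE | exact: hE].
Qed.

Lemma fgproj_prod P Q : fgproj P -> fgproj Q -> fgproj (P * Q)%type.
Proof.
by move=> [Pf Pp] [Qf Qp]; split; [exact: fingen_prod | exact: projective_prod].
Qed.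

Lemma projective_retract P X (s : {linear X -> P}) (r : {linear P -> X}) :
  (forall x, r (s x) = x) -> projective P -> projective X.
Proof.
move=> rs Pp M N p f pS; have [g gE] := Pp _ _ p (f \o r : {linear P -> N}) pS.
by exists (g \o s : {linear X -> M}) => x /=; rewrite gE /= rs.
Qed.

(** The functionals are the coordinates of a splitting of a free cover of [P]. *)
Lemma dual_basis P : fgproj P ->
  exists n (g : 'I_n -> P) (l : 'I_n -> {linear P -> S^o}),
    forall y, y = \sum_i (l i y : S) *: g i.
Proof.
move=> [Pf Pp]; have [n [f fS]] := fingen_cover Pf.
have [s sE] := Pp _ _ f (idfun : {linear P -> P}) fS.
have lL i : linear (fun y => s y i : S^o) by move=> a x y; rewrite linearP !ffunE.
exists n, (fun i => f (delta i)), (fun i => mklin (lL i)) => y.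
rewrite -[LHS]sE [in LHS](free_basis (s y)) linear_sum.
by apply: eq_bigr => i _; rewrite linearZ.
Qed.
End FinitelyGenerated.

(** * Summands in complexes of projectives *)

Section FrobeniusSequences.
Variable S : pzRingType.
Implicit Types X Y Z P Q T W : lmodType S.

(** For an injective [a] into a projective this is the vanishing of Ext^1(coker a, S): exactness of
    the dual complex, expressed on one short exact piece. *)
Definition extends_functionals X P (a : {linear X -> P}) : Prop :=
  forall phi : {linear X -> S^o}, exists psi : {linear P -> S^o},
    forall x, psi (a x) = phi x.

(** One piece of a totally acyclic complex: splicing a two-sided sequence of such pieces gives the
    complex back. In the category of Gorenstein-projectives these are sequences of its Frobenius
    structure. *)
Definition frobenius X P Y (a : {linear X -> P}) (b : {linear P -> Y}) : Prop :=
  [/\ fgproj P, injective a, forall p, b p = 0 <-> exists x, a x = p,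
      forall y, exists p, b p = y & extends_functionals a].

Definition frobenius_linked X Y : Prop :=
  exists P (a : {linear X -> P}) (b : {linear P -> Y}), frobenius a b.

(** A dual basis of [T] reduces the extension to its finitely many coordinate functionals. Finitely
    generated projectives thus behave as injectives relative to [a]. *)
Lemma extends_to_fgproj X P T (a : {linear X -> P}) :
  extends_functionals a -> fgproj T ->
  forall phi : {linear X -> T}, exists psi : {linear P -> T},
    forall x, psi (a x) = phi x.
Proof.
move=> aE /dual_basis[n [g [l lE]]] phi.
have /choice[psi psiE] i := aE (l i \o phi : {linear X -> S^o}).
have pL : linear (fun p => [ffun i => psi i p] : free_mod S n).
  by move=> s x y; apply/ffunP => i; rewrite !ffunE linearP.
exists (free_map g \o mklin pL : {linear P -> T}) => x.
rewrite [RHS]lE; apply: eq_bigr => i _.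
by congr (_ *: _); rewrite ffunE; exact: psiE.
Qed.

Lemma frobenius_lift X P Y (a : {linear X -> P}) (b : {linear P -> Y}) Q
    (g : {linear Q -> Y}) :
  frobenius a b -> projective Q -> exists h : {linear Q -> P}, forall x, b (h x) = g x.
Proof. by case=> _ _ _ bS _ Qp; exact: Qp. Qed.

(** Summands are taken in Z_i x Q with Q projective. To form a cosyzygy this product must stand at
    the left end of a sequence, to form a syzygy at the right end; hence two variants. *)
Lemma frobenius_prodr X P Y (a : {linear X -> P}) (b : {linear P -> Y}) Q :
  frobenius a b -> fgproj Q ->
  frobenius (lin_pair (a \o fst : {linear (X * Q)%type -> P})
                      (snd : {linear (X * Q)%type -> Q}))
            (b \o fst : {linear (P * Q)%type -> Y}).
Proof.
move=> [Pp aI ab bS aE] Qp; split.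
- exact: fgproj_prod.
- by move=> [x q] [x' q'] /= [/aI-> ->].
- move=> [p q]; split=> [/ab[/= x <-]|[[x q'] /= [<- _]]]; first by exists (x, q).
  by apply/ab; exists x.
- by move=> y; have [p <-] := bS y; exists (p, 0).
move=> phi; have [psi psiE] := aE (phi \o lin_inl X Q : {linear X -> S^o}).
exists (lin_copair psi (phi \o lin_inr X Q : {linear Q -> S^o})) => x.
by rewrite [in RHS](pairE x) [RHS]raddfD; congr (_ + _); exact: psiE.
Qed.

Lemma frobenius_prodl X P Y (a : {linear X -> P}) (b : {linear P -> Y}) Q :
  frobenius a b -> fgproj Q ->
  frobenius (lin_inl P Q \o a : {linear X -> (P * Q)%type})
            (lin_pair (b \o fst : {linear (P * Q)%type -> Y})
                      (snd : {linear (P * Q)%type -> Q})).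
Proof.
move=> [Pp aI ab bS aE] Qp; split.
- exact: fgproj_prod.
- by move=> x x' /= [/aI].
- move=> [p q]; split=> /= [[/ab[x <-] ->]|[x [<- <-]]]; first by exists x.
  by congr (_, _); apply/ab; exists x.
- by move=> [y q]; have [p <-] := bS y; exists (p, q).
move=> phi; have [psi psiE] := aE phi.
by exists (psi \o fst : {linear (P * Q)%type -> S^o}).
Qed.

Definition noetherian_ring : Prop := forall X Y (f : {linear Y -> X}),
  injective f -> fingen X -> fingen Y.
Definition has_approximations : Prop := forall X, fingen X ->
  exists Q (a : {linear X -> Q}), fgproj Q /\ extends_functionals a.

Hypothesis noetherian : noetherian_ring.
Hypothesis approximable : has_approximations.

Definition retract X W : Prop :=
  exists (s : {linear X -> W}) (r : {linear W -> X}), forall x, r (s x) = x.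

Lemma retract_trans X Y W : retract X Y -> retract Y W -> retract X W.
Proof.
move=> [s [r rs]] [s' [r' rs']].
exists (s' \o s : {linear X -> W}), (r \o r' : {linear W -> X}) => x /=.
by rewrite rs' rs.
Qed.

Lemma retract_fingen X W : retract X W -> fingen W -> fingen X.
Proof. by move=> [s [r rs]]; apply: (fingen_surj (f := r)) => x; exists (s x). Qed.

(* The section s and retraction r of X extend to the middle terms and so induce s' and r'
   on the cokernels; r' s' - id then factors through the projective Q. *)
Lemma cosyzygy_retract X W P Y (a : {linear W -> P}) (b : {linear P -> Y}) :
  frobenius a b -> retract X W ->
  exists X' Q, [/\ frobenius_linked X X', fgproj Q & retract X' (Y * Q)%type].
Proof.
move=> ab [s [r rs]]; have [Pp aI abE bS aE] := ab.
have Xf : fingen X.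
  by apply: (retract_fingen (W := W)); [exists s, r | apply: noetherian aI (proj1 Pp)].
have [Q [i [Qp iE]]] := approximable Xf.
have [sg sgE] := extends_to_fgproj iE Pp (a \o s : {linear X -> P}).
have [rh rhE] := extends_to_fgproj aE Qp (i \o r : {linear W -> Q}).
(* The approximation is injective because the injective map [a \o s] factors through it, as
   [sg \o i]. *)
have iI : injective i.
  by move=> x y xy; rewrite -[x]rs -[y]rs; congr (r _); apply: aI;
     rewrite -[LHS]sgE -[RHS]sgE xy.
pose c := lcokpi i.
have ci x : c (i x) = 0 by apply/lcokpi_eq0; exists x.
exists (lcok i), Q; split=> //.
  by exists Q, i, c; split=> //; [move=> p; exact: lcokpi_eq0 | exact: lcokpi_surj].
have ba x : b (a x) = 0 by apply/abE; exists x.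
have [|s' s'E] := factor_surj (b := c) (g := b \o sg : {linear Q -> Y})
    (@lcokpi_surj _ _ _ i).
  by move=> x /lcokpi_eq0[y <-] /=; rewrite sgE /= ba.
have [|r' r'E] := factor_surj (b := b) (g := c \o rh : {linear P -> lcok i}) bS.
  by move=> p /abE[y <-]; apply: etrans (congr1 c (rhE y)) (ci _).
have [|t tE] := factor_surj (b := c) (g := rh \o sg \- idfun : {linear Q -> Q})
    (@lcokpi_surj _ _ _ i).
  by move=> x /lcokpi_eq0[y <-] /=; rewrite sgE /= rhE /= rs subrr.
exists (lin_pair s' t), (lin_copair r' (\- c : {linear Q -> lcok i})) => x'.
have [x <-] := lcokpi_surj x'; rewrite -/c /= s'E tE /= r'E /= raddfB.
by rewrite opprB addrC subrK.
Qed.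

(** Dual to [cosyzygy_retract], with a free cover in place of the approximation. One point has no
    counterpart there: the new sequence does not come with the extension of functionals, which has
    to be transported from [a]. *)
Lemma syzygy_retract X W P Y (a : {linear Y -> P}) (b : {linear P -> W}) :
  frobenius a b -> retract X W ->
  exists X' Q, [/\ frobenius_linked X' X, fgproj Q & retract X' (Y * Q)%type].
Proof.
move=> ab [s [r rs]]; have [Pp aI abE bS aE] := ab.
have Xf : fingen X.
  by apply: (retract_fingen (W := W)); [exists s, r | apply: (fingen_surj bS) (proj1 Pp)].
have [n [c cS]] := fingen_cover Xf; set Q := free_mod S n in c cS.
have Qp : fgproj Q := free_fgproj S n.
pose i := mkerval c.
have [sg sgE] := frobenius_lift (s \o c : {linear Q -> W}) ab (proj2 Qp).
have [rh rhE] := proj2 Pp _ _ c (r \o b : {linear P -> X}) cS.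
have ci x : c (i x) = 0 by exact: mkervalP.
have ba x : b (a x) = 0 by apply/abE; exists x.
have [|s' s'E] := factor_inj (g := sg \o i : {linear mker c -> P}) aI.
  by move=> x; apply/abE; rewrite /= sgE /= ci raddf0.
have [|r' r'E] := factor_inj (a := i) (g := rh \o a : {linear Y -> Q})
    (@mkerval_inj _ _ _ c).
  by move=> y; apply: mker_elt; rewrite /= rhE /= ba raddf0.
have [|t tE] := factor_inj (a := i) (g := rh \o sg \- idfun : {linear Q -> Q})
    (@mkerval_inj _ _ _ c).
  by move=> x; apply: mker_elt; rewrite /= raddfB /= rhE /= sgE /= rs subrr.
have r's' x : r' (s' x) = x + t (i x).
  apply: (@mkerval_inj _ _ _ c).
  transitivity (rh (sg (i x))); first by rewrite -/i r'E /= s'E.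
  by rewrite linearD; rewrite -[mkerval c (t _)]/(i _) tE /= addrC subrK.
exists (mker c), Q; split=> //; last first.
  exists (lin_pair s' i), (lin_copair r' (\- t : {linear Q -> mker c})) => x.
  by rewrite /= r's' addrK.
exists Q, i, c; split=> //; first exact: mkerval_inj.
  move=> p; split=> [/mker_elt[y yE]|[y <-]]; first by exists y.
  exact: mkervalP.
(* Extending [phi \o r'] along [a] and composing with [sg] gives phi (r' s' x) = phi x + phi (t (i
   x)) on the kernel; the surplus is the restriction of [phi \o t], which is subtracted. *)
move=> phi; have [psi psiE] := aE (phi \o r' : {linear Y -> S^o}).
exists (psi \o sg \- (phi \o t) : {linear Q -> S^o}) => x.
transitivity (psi (a (s' x)) - phi (t (i x))); first by rewrite s'E.
by rewrite psiE /= r's' raddfD addrK.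
Qed.

Definition frobenius_chain (Z : int -> lmodType S) : Prop :=
  forall i, frobenius_linked (Z i) (Z (i + 1)).

(** The projective [Q] makes the class stable: a syzygy or cosyzygy of a summand is a summand of the
    neighbouring term only after a projective is added. *)
Definition chain_summand X : Prop := exists (Z : int -> lmodType S) i Q,
  [/\ frobenius_chain Z, fgproj Q & retract X (Z i * Q)%type].

Lemma chain_summand_next X : chain_summand X ->
  exists Y, chain_summand Y /\ frobenius_linked X Y.
Proof.
move=> [Z [i [Q [Zc Qp XW]]]]; have [P [a [b ab]]] := Zc i.
have [Y [Q' [XY Q'p YW]]] := cosyzygy_retract (frobenius_prodr ab Qp) XW.
by exists Y; split=> //; exists Z, (i + 1), Q'.
Qed.

Lemma chain_summand_prev X : chain_summand X ->
  exists Y, chain_summand Y /\ frobenius_linked Y X.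
Proof.
move=> [Z [i [Q [Zc Qp XW]]]]; have := Zc (i - 1); rewrite subrK => -[P [a [b ab]]].
have [Y [Q' [XY Q'p YW]]] := syzygy_retract (frobenius_prodl ab Qp) XW.
by exists Y; split=> //; exists Z, (i - 1), Q'.
Qed.

Lemma chain_through_summand X : chain_summand X ->
  exists Z : int -> lmodType S, Z 0 = X /\ frobenius_chain Z.
Proof.
move=> cX; pose T := {Y : lmodType S | chain_summand Y}.
have /choice[nx nxE] (Y : T) : exists Y' : T, frobenius_linked (sval Y) (sval Y').
  by have [Y' [cY' YY']] := chain_summand_next (svalP Y); exists (exist _ Y' cY').
have /choice[pv pvE] (Y : T) : exists Y' : T, frobenius_linked (sval Y') (sval Y).
  by have [Y' [cY' YY']] := chain_summand_prev (svalP Y); exists (exist _ Y' cY').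
pose X0 : T := exist _ X cX.
(* [Negz n] is -(n+1), hence the n+1 backward steps; both branches start from [X], which sits at
   0. *)
exists (fun i => match i with Posz n => sval (iter n nx X0)
                          | Negz n => sval (iter n.+1 pv X0) end).
split=> // -[n|[|n]].
- by rewrite -PoszD addn1; exact: nxE.
- exact: pvE.
have -> : Negz n.+1 + 1 = Negz n by rewrite !NegzE -addn1 PoszD opprD addrNK.
exact: pvE.
Qed.
End FrobeniusSequences.

(** * Totally acyclic complexes as chains of short exact sequences *)

Section GorensteinProjective.
Variable R : pzRingType.
Implicit Types G X Y : rmod R.

(** The chain consists of the kernels of the differentials. *)
Lemma gp_chain G : gorenstein_projective G ->
  exists (Z : int -> rmod R) i, frobenius_chain Z /\ iso G (Z i).
Proof.
move=> [P [d [[Pf Pp dex dual] [i [j [jI jE]]]]]].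
exists (fun i => mker (d i)), (i + 1); split; last first.
  have [|h hE] := mker_lift (f := d (i + 1)) (g := j).
    by move=> x; apply/dex; apply/jE; exists x.
  exists h; apply: inj_surj_bij => [x y xy|y]; first by apply: jI; rewrite -!hE xy.
  have /dex/jE[x xE] := mkervalP y; exists x.
  by apply: (@mkerval_inj _ _ _ (d (i + 1))); rewrite hE.
(* Two predecessors are made visible in the index, because exactness is stated at [i + 1] and the
   dual condition compares maps on [P (i + 1)] and [P (i + 1 + 1)]. *)
move=> j'; have [l ->] : exists l, j' = l + 1 + 1 by exists (j' - 1 - 1); rewrite !subrK.
have dd m x : d (m + 1) (d m x) = 0 by apply/dex; exists x.
have [b bE] := mker_lift (dd (l + 1 + 1)).
exists (P (l + 1 + 1)), (mkerval (d (l + 1 + 1))), b; split.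
- by split.
- exact: mkerval_inj.
- move=> p; split=> [bp|[x <-]].
    by apply: mker_elt; rewrite -bE bp raddf0.
  by apply: (@mkerval_inj _ _ _ (d (l + 1 + 1 + 1))); rewrite bE mkervalP raddf0.
- move=> y; have /dex[p pE] := mkervalP y; exists p.
  by apply: (@mkerval_inj _ _ _ (d (l + 1 + 1 + 1))); rewrite bE.
(* Here [c] is [d (l + 1)] seen as a map onto the kernel. Then [phi \o c] kills the image of [d l],
   and dual exactness extends it over [d (l + 1)]. *)
move=> phi; have [c cE] := mker_lift (dd (l + 1)).
have [|psi psiE] := (proj1 (dual l (phi \o c : {linear P (l + 1) -> regular_rmod R}))).
  move=> x; rewrite /= (_ : c (d l x) = 0) ?raddf0 //.
  by apply: (@mkerval_inj _ _ _ (d (l + 1 + 1))); rewrite cE dd raddf0.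
exists psi => x; have /dex[p pE] := mkervalP x; rewrite -pE psiE /=; congr (phi _).
by apply: (@mkerval_inj _ _ _ (d (l + 1 + 1))); rewrite cE.
Qed.

(** Splicing: the differential is P_l -> Z_{l+1} -> P_{l+1}. A functional killed by it descends to
    the next term of the chain and then extends by the last clause of [frobenius]. *)
Lemma chain_gp G (Z : int -> rmod R) i :
  frobenius_chain Z -> iso G (Z i) -> gorenstein_projective G.
Proof.
move=> Zc; pose P i := projT1 (cid (Zc i)); pose cP i := projT2 (cid (Zc i)).
pose a i : {linear Z i -> P i} := projT1 (cid (cP i)).
pose ca i := projT2 (cid (cP i)).
pose b i : {linear P i -> Z (i + 1)} := projT1 (cid (ca i)).
have ab l : frobenius (a l) (b l) := projT2 (cid (ca l)).
have aI l : injective (a l) by case: (ab l).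
have abE l p : b l p = 0 <-> exists x, a l x = p by case: (ab l).
have bS l y : exists p, b l p = y by case: (ab l).
pose d l : {linear P l -> P (l + 1)} := a (l + 1) \o b l.
have ba l x : b l (a l x) = 0 by apply/abE; exists x.
have dE l x : d (l + 1) x = 0 <-> exists z, a (l + 1) z = x.
  rewrite -abE; split=> [|bx]; last by rewrite /d /= bx raddf0.
  by rewrite -[RHS](raddf0 (a (l + 1 + 1))) => /aI.
have [m ->] : exists m, i = m + 1 by exists (i - 1); rewrite subrK.
move=> [h [h' hK h'K]]; exists P, d; split; last first.
  exists m, (a (m + 1) \o h : {linear G -> P (m + 1)}); split.
    by move=> x y /aI/(can_inj hK).
  move=> y; split=> [[x <-]|[z <-]].
    by have [p pE] := bS m (h x); exists p; rewrite /d /= pE.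
  by exists (h' (b m z)); rewrite /= h'K.
split=> [l|l|l x|l f]; try by case: (ab l) => -[].
  rewrite dE; split=> [[z <-]|[y <-]]; last by exists (b l y).
  by have [p <-] := bS l z; exists p.
split=> [fd|[g gE] x]; last by rewrite -gE /d /= ba !raddf0.
have fa x : b (l + 1) x = 0 -> f x = 0.
  by move=> /abE[z <-]; have [p <-] := bS l z; exact: fd.
have [g gE] := factor_surj (bS (l + 1)) fa.
have [_ _ _ _ aE] := ab (l + 1 + 1); have [g' g'E] := aE g.
by exists g' => x; rewrite /d /= g'E gE.
Qed.

Lemma gp_iso X Y : iso X Y -> gorenstein_projective X -> gorenstein_projective Y.
Proof.
move=> /iso_sym[f fB] [P [d [dT [i [j [jI jE]]]]]]; exists P, d; split=> //.
case: (fB) => g fK gK.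
exists i, (j \o f : {linear Y -> P (i + 1)}); split.
  by move=> x y /jI/(can_inj fK).
move=> y; rewrite -jE; split=> [[x <-]|[x <-]]; first by exists (f x).
by exists (g x); rewrite /= gK.
Qed.

Lemma gp_fingen X : gorenstein_projective X -> fingen X.
Proof.
move=> [P [d [[Pf _ _ _] [i [j [jI jE]]]]]].
have [x|f fE] := factor_inj (g := d i) jI; first by apply/jE; exists x.
apply: (fingen_surj (f := f)) (Pf i) => x.
have [z zE] : exists z, d i z = j x by apply/jE; exists x.
by exists z; apply: jI; rewrite fE.
Qed.

Hypothesis noetherian : noetherian_ring R^c.
Hypothesis approximable : has_approximations R^c.

Lemma gp_retract X G : gorenstein_projective G -> retract X G -> gorenstein_projective X.
Proof.
move=> /gp_chain[Z [i [Zc [h [h' hK h'K]]]]] XG.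
have [|Z' [Z'0 Z'c]] := chain_through_summand noetherian approximable (X := X).
  (* At the start no projective has to be added, so the zero module is taken for it. *)
  exists Z, i, (free_mod _ 0); split=> //; first exact: free_fgproj.
  apply: retract_trans XG _.
  exists (lin_inl _ _ \o h : {linear G -> (Z i * free_mod _ 0)%type}).
  exists (mklin (inv_linear hK h'K) \o fst : {linear (Z i * free_mod _ 0)%type -> G}).
  by move=> x; exact: hK.
by apply: (chain_gp (i := 0) Z'c); rewrite Z'0; exact: iso_refl.
Qed.

Lemma gp_syzygy G : gorenstein_projective G -> exists (H P : rmod R)
  (a : {linear H -> P}) (b : {linear P -> G}), gorenstein_projective H /\ frobenius a b.
Proof.
move=> /gp_chain[Z [i [Zc]]].
have [m ->] : exists m, i = m + 1 by exists (i - 1); rewrite subrK.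
move=> /iso_sym[h hB]; have [P [a [b [Pp aI ab bS aE]]]] := Zc m.
have [h' hK h'K] := hB.
exists (Z m), P, a, (h \o b : {linear P -> G}); split.
  by apply: (chain_gp Zc); exact: iso_refl.
split=> //.
  move=> p; rewrite -ab; split=> [|bp]; last by rewrite /= bp raddf0.
  by rewrite -[RHS](raddf0 h) => /(can_inj hK).
by move=> y; have [p pE] := bS (h' y); exists p; rewrite /= pE h'K.
Qed.
End GorensteinProjective.

(** * Finite-dimensional algebras *)

Section FiniteDimension.
Variable K : fieldType.
Implicit Types V W : rmod K.

Definition spanned n V : Prop :=
  exists g : 'I_n -> V, forall x, exists c : 'I_n -> K^c, x = \sum_i c i *: g i.

(** Gaussian elimination, one generator at a time. A subspace is a mere predicate, so the induction
    can shrink it without forming submodules. *)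
Lemma subspace_fingen n V (g : 'I_n -> V) (P : V -> Prop) :
  (forall s x y, P x -> P y -> P (x + s *: y)) ->
  (forall x, P x -> exists c : 'I_n -> K^c, x = \sum_i c i *: g i) ->
  exists m (h : 'I_m -> V), (forall i, P (h i)) /\
    forall x, P x -> exists c : 'I_m -> K^c, x = \sum_i c i *: h i.
Proof.
elim: n g P => [|n IH] g P Pc Pg.
  exists 0%N, (fun=> 0); split=> [[]|x /Pg[c ->]] //.
  by exists c; rewrite !big_ord0.
pose g' i := g (lift ord0 i); pose P' x := P x /\ exists c, x = \sum_i c i *: g' i.
have [s x y [Px [c cE]] [Py [d dE]]|x []//|m [h [Ph hE]]] := IH g' P'.
  split; first exact: Pc.
  exists (fun i => c i + s * d i); rewrite cE dE scaler_sumr -big_split.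
  by apply: eq_bigr => i _; rewrite scalerDl scalerA.
have [[x0 [Px0 x0g']]|all] := pselect (exists x, P x /\ ~ exists c, x = \sum_i c i *: g' i);
  last first.
  exists m, h; split=> [i|x Px]; first by case: (Ph i).
  by apply: hE; split=> //; apply: contrapT => xg'; apply: all; exists x.
exists m.+1, (fun i => if unlift ord0 i is Some j then h j else x0).
split=> [i|x Px]; first by case: unliftP => [j|] _ //; case: (Ph j).
have [c cE] := Pg _ Px0; have [d dE] := Pg _ Px.
have c0 : (c ord0 : K) != 0.
  apply/eqP => c0; apply: x0g'; exists (fun i => c (lift ord0 i)).
  by rewrite cE big_ord_recl c0 scale0r add0r.
pose t : K^c := (c ord0 : K)^-1 * (d ord0 : K).
have tE : t * c ord0 = d ord0 by exact: (mulVKf c0).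
have [|e eE] := hE (x + (- t) *: x0).
  split; first exact: Pc.
  exists (fun i => d (lift ord0 i) - t * c (lift ord0 i)).
  rewrite dE cE !big_ord_recl scalerDr scalerA mulNr tE addrACA.
  rewrite -scalerDl subrr scale0r add0r scaler_sumr -big_split.
  by apply: eq_bigr => i _; rewrite /= scalerDl scalerA mulNr.
exists (fun i => if unlift ord0 i is Some j then e j else t).
rewrite big_ord_recl unlift_none.
under eq_bigr => i _ do rewrite liftK.
by rewrite -eE scaleNr addrC subrK.
Qed.

Lemma field_noetherian : noetherian_ring K^c.
Proof.
move=> V W f fI [n [g gE]].
have [s _ _ [x <-] [y <-]|x _|m [h [hP hE]]] :=
    subspace_fingen (g := g) (P := fun y => exists x, f x = y).
- by exists (x + s *: y); rewrite linearD linearZ.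
- exact: gE.
have [h' h'E] := choice hP.
exists m, h' => x; have [|c cE] := hE (f x); first by exists x.
exists c; apply: fI; rewrite cE linear_sum.
by apply: eq_bigr => i _; rewrite linearZ /= h'E.
Qed.

(** A nonzero coefficient of [z] turns [f z = 0] into a relation that expresses one generator of the
    image by the others. The strict drop drives the induction that finds an indecomposable
    summand. *)
Lemma spanned_proper_quotient n V W (f : {linear V -> W}) z :
  (forall y, exists x, f x = y) -> z != 0 -> f z = 0 -> spanned n V ->
  exists2 m, (m < n)%N & spanned m W.
Proof.
move=> fS z0 fz [g gE]; have [c cE] := gE z.
have /existsP[i ci] : [exists i, (c i : K) != 0].
  apply: contraNT z0; rewrite negb_exists => /forallP c0; rewrite cE big1 // => i _.
  by rewrite (eqP (negPn (c0 i))) scale0r.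
case: n => [|n] in g gE c cE i ci *; first by case: i ci.
exists n => //; exists (fun j => f (g (lift i j))) => y.
have [x <-] := fS y; have [d ->] := gE x; pose t : K^c := (c i : K)^-1 * (d i : K).
have tE : t * c i = d i by exact: (mulVKf ci).
have fgi : c i *: f (g i) = - \sum_j c (lift i j) *: f (g (lift i j)).
  apply/eqP; rewrite -addr_eq0 -[X in _ == X]fz [in f z]cE (bigD1_ord i) //=.
  rewrite linearD linear_sum linearZ.
  by apply/eqP; congr (_ + _); apply: eq_bigr => j _; rewrite linearZ.
exists (fun j => d (lift i j) - t * c (lift i j)).
rewrite (bigD1_ord i) //= linearD linearZ /= -tE -scalerA fgi.
rewrite [f (\sum_j _)]linear_sum scalerN scaler_sumr -sumrN -big_split.
by apply: eq_bigr => j _ /=; rewrite scalerA [f (_ *: _)]linearZ addrC scalerBl.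
Qed.
End FiniteDimension.

(** Rings carry no k-structure here, so it is supplied as a central ring morphism; finite dimension
    is finite generation over k through that morphism. *)
Record finite_algebra (k : fieldType) (R : pzRingType) := FiniteAlgebra {
  scal :> {rmorphism k -> R};
  scalC : forall c x, scal c * x = x * scal c;
  scal_fin : fingen (inflation_obj scal (regular_rmod R)) }.

Section FiniteAlgebra.
Variables (k : fieldType) (R : pzRingType) (kR : finite_algebra k R).
Implicit Types M N X Y : rmod R.

Definition kmod M : rmod k := inflation_obj kR M.

Lemma kmod_fingen M : fingen M <-> fingen (kmod M).
Proof.
split=> [[n [g gE]]|[n [g gE]]]; last first.
  exists n, g => x; have [c cE] := gE x.
  by exists (fun i => kR (c i)); exact: cE.
have [m [h hE]] := scal_fin kR.
apply: (fingen_fin (g := fun p : 'I_n * 'I_m => (h p.2 : R^c) *: g p.1 : kmod M)) => x.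
have [a ->] := gE x; have /choice[c cE] i := hE (a i).
exists (fun p => c p.1 p.2).
rewrite -(pair_bigA _ (fun i j => (c i j : k^c) *: ((h j : R^c) *: g i : kmod M))) /=.
apply: eq_bigr => i _; rewrite [a i]cE.
apply: etrans (scaler_suml (g i) _ _ _) _.
by apply: eq_bigr => j _; exact: esym (scalerA (kR (c i j) : R^c) (h j : R^c) (g i)).
Qed.

Lemma finite_algebra_noetherian : noetherian_ring R^c.
Proof.
move=> X Y f fI /kmod_fingen Xf; apply/kmod_fingen.
exact: (field_noetherian (f := inflation_map (f := kR) f : {linear kmod Y -> kmod X})).
Qed.

Definition scal_act M (c : k) (x : M) : M := (kR c : R^c) *: x.
Lemma scal_act_linear M c : linear (@scal_act M c).
Proof.
move=> r x y; rewrite /scal_act scalerDr !scalerA; congr (_ *: _ + _).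
exact: esym (scalC kR c (r : R)).
Qed.
Lemma scal_actD M c d (x : M) : scal_act (c + d) x = scal_act c x + scal_act d x.
Proof. by rewrite /scal_act raddfD scalerDl. Qed.
Lemma scal_act1 M (x : M) : scal_act 1 x = x.
Proof. by rewrite /scal_act rmorph1; exact: scale1r. Qed.
Lemma scal_actM M c d (x : M) : scal_act (c * d) x = scal_act c (scal_act d x).
Proof. by rewrite /scal_act scalerA [c * d]mulrC; congr (_ *: x); exact: (rmorphM kR d c). Qed.

(** With [M] seen as a k-R-bimodule, Hom_R(M, N) becomes a k-vector space as an instance of
    [bhom_obj]. *)
Definition scal_bimod M : bimod k R :=
  mk_bimod (@scal_act_linear M) (@scal_actD M) (@scal_act1 M) (@scal_actM M).

(** Evaluation at n generators of [X] embeds Hom(X, N) into N^n, which is finite-dimensional. *)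
Lemma lhom_fingen X N : fingen X -> fingen N ->
  exists n (h : 'I_n -> {linear X -> N}), forall f : {linear X -> N},
    exists c : 'I_n -> k, forall x, f x = \sum_i (kR (c i) : R^c) *: h i x.
Proof.
move=> [n [g gE]] /kmod_fingen[m [h hE]].
pose V : rmod k := {ffun 'I_n -> kmod N}.
have Vf : fingen V.
  pose e (p : 'I_n * 'I_m) : V := [ffun j => if j == p.1 then h p.2 else 0].
  apply: (fingen_fin (g := e)) => x; have /choice[c cE] i := hE (x i).
  exists (fun p => c p.1 p.2); rewrite -(pair_bigA _ (fun i j => c i j *: e (i, j))) /=.
  apply/ffunP => i; rewrite sum_ffunE (bigD1 i) //= [X in _ + X]big1 => [|j ji].
    by rewrite addr0 [LHS]cE sum_ffunE; apply: eq_bigr => j _; rewrite !ffunE eqxx.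
  by rewrite sum_ffunE big1 // => l _; rewrite !ffunE eq_sym (negPf ji) scaler0.
pose W : rmod k := bhom_obj (scal_bimod X) N.
have EL : linear (fun f : W => [ffun i => (f : {linear X -> N}) (g i)] : V).
  move=> c f f'; apply/ffunP => i; rewrite !ffunE; congr (_ + _).
  exact: (linearZ_LR (f : {linear X -> N}) (kR c : R^c) (g i)).
have [|p [w wE]] := field_noetherian (f := mklin EL) _ Vf.
  move=> f f' /ffunP ff'; apply: linear_ext => x; have [c ->] := gE x.
  rewrite !linear_sum; apply: eq_bigr => i _; rewrite !linearZ; congr (_ *: _).
  by have := ff' i; rewrite !ffunE.
exists p, (fun i => w i) => f; have [c cE] := wE f; exists c => x.
rewrite [in LHS]cE.
have evD : zmod_morphism (fun f : W => (f : {linear X -> N}) x) by [].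
pose ev : {additive W -> N} := HB.pack (fun f : W => (f : {linear X -> N}) x)
  (GRing.isZmodMorphism.Build _ _ _ evD).
rewrite -[LHS]/(ev _) raddf_sum; apply: eq_bigr => i _.
exact: (linearZ_LR (w i : {linear X -> N}) (kR (c i) : R^c) x).
Qed.

(** The approximation has as coordinates a finite family spanning Hom(X, R) over k. Every functional
    is a k-combination of them, and it extends because the scalars are central. *)
Lemma finite_algebra_approximations : has_approximations R^c.
Proof.
move=> X Xf; have rf : fingen (regular_rmod R) by exact: regular_fingen.
have [n [h hE]] := lhom_fingen Xf rf.
have aL : linear (fun x => [ffun i => h i x] : free_mod R^c n).
  by move=> s x y; apply/ffunP => i; rewrite !ffunE linearP.
exists (free_mod _ n), (mklin aL); split; first exact: free_fgproj.
move=> phi; have [c cE] := hE phi.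
exists (free_map (fun i => kR (c i) : (R^c)^o)) => x.
rewrite [RHS]cE; apply: eq_bigr => i _; rewrite ffunE.
exact: (scalC kR (c i) (h i x : R)).
Qed.

Lemma bhom_fingen (S : pzRingType) (kS : finite_algebra k S) (D : bimod S R) N :
  (forall c x, (lact D (kS c) : endo D) x = (kR c : R^c) *: x) ->
  fingen D -> fingen N -> fingen (bhom_obj D N).
Proof.
move=> Dk Df Nf; have [n [h hE]] := lhom_fingen Df Nf.
exists n, (fun i => h i : bhom_obj D N) => f; have [c cE] := hE (f : {linear D -> N}).
exists (fun i => kS (c i)); apply: linear_ext => x; rewrite cE.
have evD : zmod_morphism (fun f : bhom_obj D N => (f : {linear D -> N}) x) by [].
pose ev : {additive bhom_obj D N -> N} := HB.pack (fun f : bhom_obj D N => (f : {linear D -> N}) x)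
  (GRing.isZmodMorphism.Build _ _ _ evD).
rewrite -[RHS]/(ev _) raddf_sum; apply: eq_bigr => i _.
by rewrite -linearZ -Dk.
Qed.

(* Take a nonprojective retract spanned by as few vectors as possible. *)
Lemma indecomposable_nonprojective_retract X : fingen X -> ~ projective X ->
  exists Y : rmod R, [/\ retract Y X, indecomposable Y & ~ projective Y].
Proof.
move=> /kmod_fingen[n Xn]; have {Xn}: spanned n (kmod X) by exact: Xn.
elim/ltn_ind: n X => n IH X Xn Xp.
have [Xi|Xi] := pselect (indecomposable X).
  by exists X; split=> //; exists (idfun : {linear X -> X}), (idfun : {linear X -> X}).
have zproj (Z : rmod R) : zero_module Z -> projective Z.
  move=> Z0 M N p f _; exists (\0 : {linear Z -> M}) => x.
  by rewrite [x]Z0 /= !raddf0.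
(* A decomposition with nonprojective [Y] and nonzero [Y'] suffices: the projection onto [Y] kills a
   nonzero vector, so [Y] is spanned by fewer vectors than [X]. *)
suff [Y [Y' [XYr Yp]]] : exists Y Y' : rmod R,
    (iso X (Y * Y')%type /\ ~ zero_module Y') /\ ~ projective Y.
  move: XYr => [[u [v uK vK]] Y'0].
  have YX : retract Y X.
    exists (mklin (inv_linear uK vK) \o lin_inl Y Y' : {linear Y -> X}).
    by exists (fst \o u : {linear X -> Y}) => y /=; rewrite vK.
  have [y' y'0] : exists y', y' <> 0 :> Y'.
    by apply: contrapT => H; apply: Y'0 => y; apply: contrapT => y0; apply: H; exists y.
  have [m mn Ym] : exists2 m, (m < n)%N & spanned m (kmod Y).
    apply: (spanned_proper_quotient
      (f := inflation_map (f := kR) (fst \o u : {linear X -> Y})) (z := v (0, y'))) Xn.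
    - by move=> y; exists (v (y, 0)); rewrite /inflation_map /= vK.
    - by apply/eqP => /(congr1 u); rewrite vK raddf0 => -[].
    - by rewrite /inflation_map /= vK.
  have [Z [ZY Zi Zp]] := IH m mn Y Ym Yp.
  by exists Z; split=> //; exact: retract_trans ZY YX.
(* Without such a decomposition, both factors of any proper splitting of [X] are projective, and
   then so is [X]. *)
apply: contrapT => H; apply: Xi; split=> [/zproj//|Y Y' XY].
apply: contrapT => YY'.
have Y0 : ~ zero_module Y by move=> Z; apply: YY'; left.
have Y'0 : ~ zero_module Y' by move=> Z; apply: YY'; right.
have Yp : projective Y by apply: contrapT => Yp; apply: H; exists Y, Y'.
have Y'p : projective Y'.
  apply: contrapT => Y'p; apply: H; exists Y', Y; split=> //; split=> //.
  move: XY => [u [v uK vK]].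
  exists (lin_pair (snd \o u : {linear X -> Y'}) (fst \o u : {linear X -> Y})).
  exists (fun z => v (z.2, z.1)) => [x|[y y']] /=; last by rewrite vK.
  by rewrite -surjective_pairing uK.
apply: Xp; move: XY => [u [v uK vK]].
exact: (projective_retract (s := u) (r := mklin (inv_linear uK vK))) (projective_prod Yp Y'p).
Qed.
End FiniteAlgebra.

Section FiniteAlgebraInstances.
Variable k : fieldType.

Lemma rquot_finite (R : pzRingType) (kR : finite_algebra k R) (I : ideal R) :
  exists kQ : finite_algebra k (rquot I), forall c, kQ c = rpi I (kR c).
Proof.
pose f : {rmorphism k -> rquot I} := rpi I \o kR.
have fC c x : f c * x = x * f c.
  by have [y ->] := rpi_surj x; rewrite -[f c]/(rpi I (kR c)) -!rmorphM scalC.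
have ff : fingen (inflation_obj f (regular_rmod (rquot I))).
  have [n [g gE]] := scal_fin kR.
  exists n, (fun i => rpi I (g i)) => x; have [y ->] := rpi_surj x.
  have [c ->] := gE y; exists c; rewrite raddf_sum; apply: eq_bigr => i _.
  exact: (rmorphM (rpi I) (g i : R) (kR (c i))).
by exists (FiniteAlgebra fC ff).
Qed.

Lemma endo_finite (R : pzRingType) (kR : finite_algebra k R) (M : rmod R) :
  fingen M -> exists kE : finite_algebra k (endo M),
    forall c x, (kE c : endo M) x = (kR c : R^c) *: x.
Proof.
move=> Mf; pose f : {rmorphism k -> endo M} := lact (scal_bimod kR M).
have fC c x : f c * x = x * f c.
  by apply: linear_ext => m; exact: esym (linearZ_LR (x : {linear M -> M}) (kR c : R^c) m).
have ff : fingen (inflation_obj f (regular_rmod (endo M))).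
  have [n [h hE]] := lhom_fingen kR Mf Mf.
  exists n, (fun i => h i : endo M) => x; have [c cE] := hE (x : {linear M -> M}).
  exists c; apply: linear_ext => m; rewrite cE.
  have evD : zmod_morphism (fun g : endo M => (g : {linear M -> M}) m) by [].
  pose ev : {additive endo M -> M} := HB.pack (fun g : endo M => (g : {linear M -> M}) m)
    (GRing.isZmodMorphism.Build _ _ _ evD).
  rewrite -[RHS]/(ev _) raddf_sum; apply: eq_bigr => i _.
  exact: esym (linearZ_LR (h i) (kR (c i) : R^c) m).
by exists (FiniteAlgebra fC ff).
Qed.
End FiniteAlgebraInstances.

Lemma malgZU (k : fieldType) (T : choiceType) (c d : k) (t : T) :
  c *: << d *g t >> = << (c * d) *g t >> :> {malg k[T]}.
Proof. by apply/malgP => u; rewrite mcoeffZ !mcoeffU mulrnAr. Qed.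

(** * Quotients of path algebras by admissible ideals *)

Section PathAlgebraQuotient.
Variables (k : fieldType) (Q : quiver).
Local Notation kQ := (path_alg k Q).
Implicit Types (c d : k) (x y : kQ) (p q : qpath Q).

Lemma pmulZ c d p q : pmul p q (c * d) = c *: pmul p q d.
Proof.
by rewrite /pmul; case: (_ == _); [rewrite malgZU | rewrite scaler0].
Qed.

Lemma path_scalerAl c x y : (c *: x) * y = c *: (x * y).
Proof.
move: x; apply: (@path_alg_ind k Q (fun x => path_alg_mul (c *: x) y)
  (fun x => c *: path_alg_mul x y)) => [x x'|x x'|a p].
- by rewrite scalerDr path_mulDl.
- by rewrite path_mulDl scalerDr.
move: y; apply: (@path_alg_ind k Q (path_alg_mul (c *: << a *g p >>))
  (fun y => c *: path_alg_mul << a *g p >> y)) => [y y'|y y'|b q].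
- exact: path_mulDr.
- by rewrite path_mulDr scalerDr.
rewrite malgZU; apply: etrans (path_mulUU _ _ _ _) _.
apply: etrans (esym (congr1 ( *:%R c) (path_mulUU a b p q))).
by rewrite -pmulZ mulrA.
Qed.

Lemma path_scalerAr c x y : x * (c *: y) = c *: (x * y).
Proof.
move: x; apply: (@path_alg_ind k Q (fun x => path_alg_mul x (c *: y))
  (fun x => c *: path_alg_mul x y)) => [x x'|x x'|a p].
- exact: path_mulDl.
- by rewrite path_mulDl scalerDr.
move: y; apply: (@path_alg_ind k Q (fun y => path_alg_mul << a *g p >> (c *: y))
  (fun y => c *: path_alg_mul << a *g p >> y)) => [y y'|y y'|b q].
- by rewrite scalerDr path_mulDr.
- by rewrite path_mulDr scalerDr.
rewrite malgZU; apply: etrans (path_mulUU _ _ _ _) _.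
apply: etrans (esym (congr1 ( *:%R c) (path_mulUU a b p q))).
by rewrite -pmulZ mulrCA.
Qed.

Lemma long_path_in_power m p : (m <= plen p)%N -> arrow_ideal_pow k Q m (path_elt k p).
Proof.
move=> mp I H.
have := valP p; rewrite -[(val p).2](cat_take_drop m) walk_cat => /andP[w1 w2].
pose p1 : qpath Q := exist _ (psrc p, take m (parr p)) w1.
pose p2 : qpath Q := exist _ (ptgt p1, drop m (parr p)) w2.
have pE : p = pcat p1 p2.
  by apply: qpath_eq; rewrite ?psrc_pcat ?parr_pcat //= cat_take_drop.
have -> : path_elt k p = path_elt k p1 * path_elt k p2.
  rewrite [in LHS]pE; apply: esym; apply: etrans (path_mulUU _ _ _ _) _.
  by rewrite /pmul eqxx mulr1.
by apply: Defs.idealMr; apply: H; exists p1 => //; rewrite /plen size_takel.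
Qed.

(** Paths of length at least [m] vanish in the quotient, and a finite quiver has finitely many
    shorter ones. *)
Lemma admissible_finite (I : ideal kQ) : admissible I ->
  exists kA : finite_algebra k (rquot I), True.
Proof.
move=> [m _ [mI _]]; pose s (c : k) : kQ := c *: (1 : kQ).
have sD : zmod_morphism s by move=> c d; exact: scalerBl.
have sM : monoid_morphism s.
  by split=> [|c d]; rewrite /s ?scale1r // path_scalerAl mul1r scalerA.
pose f0 : {rmorphism k -> kQ} := HB.pack s (GRing.isZmodMorphism.Build _ _ _ sD)
  (GRing.isMonoidMorphism.Build _ _ _ sM).
pose f : {rmorphism k -> rquot I} := rpi I \o f0.
have fE c x : rpi I x * f c = rpi I (c *: x).
  by rewrite -rmorphM; congr (rpi I _); rewrite [LHS]path_scalerAr mulr1.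
have fC c u : f c * u = u * f c.
  have [x ->] := rpi_surj u; rewrite fE -[f c]/(rpi I (s c)) -rmorphM; congr (rpi I _).
  by rewrite [LHS]path_scalerAl mul1r.
suff ff : fingen (inflation_obj f (regular_rmod (rquot I))) by exists (FiniteAlgebra fC ff).
(* This index set is generous: it allows length [m] and sequences that are not walks. [insubd] sends
   the latter to a trivial path, which does no harm in a spanning family. *)
pose T : finType := (vertex Q * m.-bseq (arrow Q))%type.
pose g (t : T) : inflation_obj f (regular_rmod (rquot I)) :=
  rpi I (path_elt k (insubd (ptriv t.1) (t.1, val t.2))).
apply: (fingen_fin (g := g)) => u; have [x ->] := rpi_surj u.
pose M := inflation_obj f (regular_rmod (rquot I)); pose pi (x : kQ) : M := rpi I x.
have piD x1 x2 : pi (x1 + x2) = pi x1 + pi x2 by exact: (raddfD (rpi I)).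
pose P (x : kQ) := exists c : T -> k^c, pi x = \sum_i c i *: g i.
have P00 x1 : pi x1 = 0 -> P x1.
  by move=> x10; exists (fun=> 0); rewrite x10 big1 // => t _; rewrite scale0r.
have P0 : P 0 by apply: P00; exact: (raddf0 (rpi I)).
have PD x1 x2 : P x1 -> P x2 -> P (x1 + x2).
  move=> [c cE] [d dE]; exists (fun t => c t + d t); rewrite piD cE dE -big_split.
  by apply: eq_bigr => t _; rewrite scalerDl.
suff Pmon a p : P (<< a *g p >> : {malg k[qpath Q]}).
  rewrite -/(P x) [x]monalgE; apply: (big_ind P) => // p _; exact: Pmon.
have aE : << a *g p >> = a *: path_elt k p by rewrite [RHS]malgZU mulr1.
have [mp|pm] := leqP m (plen p).
  apply: P00; apply/(zpi_eq0 I); rewrite aE -[path_elt k p]mul1r -path_scalerAl.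
  by apply: Defs.idealMl; apply: mI; exact: long_path_in_power.
pose t : T := (psrc p, Bseq (ltnW pm)).
exists (fun i => if i == t then a else 0).
rewrite (bigD1 t) //= eqxx [X in _ + X]big1 ?addr0; last first.
  by move=> i /negPf ->; rewrite scale0r.
have -> : g t = rpi I (path_elt k p).
  congr (rpi I (path_elt k _)); apply/val_inj; rewrite val_insubd /=.
  by have := valP p; rewrite /psrc /parr /= => ->; rewrite -surjective_pairing.
by rewrite aE; exact: esym (fE _ _).
Qed.
End PathAlgebraQuotient.

(** * Tensor products *)

Section AdditiveMaps.
Variables (U V : zmodType) (f : U -> V).

Lemma additive_zmod_morphism : {morph f : x y / x + y} -> zmod_morphism f.
Proof. by move=> fD x y; rewrite -{2}[x](subrK y) (fD (x - y)) addrK. Qed.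

Definition mkadd (fB : zmod_morphism f) : {additive U -> V} :=
  HB.pack f (GRing.isZmodMorphism.Build _ _ _ fB).
End AdditiveMaps.

Lemma zmod_scalable_linear (S : pzRingType) (U V : lmodType S) (f : U -> V) :
  zmod_morphism f -> scalable f -> linear f.
Proof. by move=> fB fZ s x y; rewrite -fZ; exact: (raddfD (mkadd fB)). Qed.

Section TensorTheory.
Variables (S R : pzRingType) (M : rmod S) (D : bimod S R).

(** The projection to the quotient by the subgroup [P] kills all pure tensors, hence agrees with the
    zero map by [tensor_ext]. *)
Lemma tensor_ind (P : tensor M D -> Prop) : subgroup_closed P ->
  (forall m d, P (tpure m d)) -> forall u, P u.
Proof.
move=> Pc Pp u; pose PS := Subgroup Pc; apply/(zpi_eq0 PS).
apply: (@tensor_ext _ _ M D _ (zpi PS) (fun=> 0)).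
- exact: raddfB.
- by move=> *; rewrite subr0.
by move=> m d; apply/zpi_eq0/Pp.
Qed.

Lemma tensor_linear (Y : rmod R) (g : M -> D -> Y) : balanced g ->
  (forall m (r : R^c) d, g m (r *: d) = r *: g m d) ->
  exists h : {linear tensor_obj D M -> Y}, forall m d, h (tpure m d) = g m d.
Proof.
move=> gb gZ; have hB : zmod_morphism (tlift g) by exact: tliftB.
have hZ : scalable (tlift g : tensor_obj D M -> Y).
  move=> r; apply: (@tensor_ext _ _ M D) => [u v|u v|m d].
  - by rewrite scalerBr hB.
  - by rewrite hB scalerBr.
  - by rewrite [r *: _]tensor_scale_pure !tlift_pure.
have hL := zmod_scalable_linear hB hZ.
by exists (mklin hL) => m d; exact: tlift_pure.
Qed.

Lemma tensor_linear_eq (Y : rmod R) (h h' : {linear tensor_obj D M -> Y}) :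
  (forall m d, h (tpure m d) = h' (tpure m d)) -> h = h'.
Proof.
move=> hh'; apply: linear_ext; apply: (@tensor_ext _ _ M D) => // u v.
  exact: (raddfB h). exact: (raddfB h').
Qed.

Lemma tpureZr m (r : R^c) (d : D) : tpure m (r *: d) = r *: (tpure m d : tensor_obj D M).
Proof. by rewrite [RHS]tensor_scale_pure. Qed.

Lemma tpureZl m (s : S^c) (d : D) :
  tpure (s *: m) d = tpure m ((lact D s : endo D) d) :> tensor_obj D M.
Proof. by case: (tpure_balanced M D) => _ _; apply. Qed.

Lemma tpureDl m m' (d : D) : tpure (m + m') d = tpure m d + tpure m' d :> tensor_obj D M.
Proof. by case: (tpure_balanced M D). Qed.

(** Meant for bimodules that are cyclic on the right: C/I is generated by 1 and eps C by eps. The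
    left scalars of m (x) d move across the tensor sign and are absorbed into multiples of [u]. *)
Lemma tensor_fingen u : (forall d : D, exists r : R^c, d = r *: u) -> fingen M ->
  fingen (tensor_obj D M).
Proof.
move=> Du [n [g gE]]; exists n, (fun i => tpure (g i) u : tensor_obj D M).
apply: tensor_ind => [|m d].
  split=> [|x y [c ->] [c' ->]]; first by exists (fun=> 0); rewrite big1 // => i _; rewrite scale0r.
  by exists (fun i => c i - c' i); rewrite -sumrB; apply: eq_bigr => i _; rewrite scalerBl.
have [s ->] := gE m; have /choice[r rE] i := Du ((lact D (s i) : endo D) d).
have tB : zmod_morphism (fun m => tpure m d : tensor_obj D M).
  by apply: additive_zmod_morphism => x y; exact: tpureDl.
exists r; rewrite -[LHS]/(mkadd tB _) raddf_sum; apply: eq_bigr => i _.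
by rewrite [LHS]tpureZl rE tpureZr.
Qed.
End TensorTheory.

(** * The functors of a quotient ring *)

Section QuotientFunctors.
Variables (C : pzRingType) (I : ideal C).
Local Notation B := (rquot I).

Definition quot_one : quot_bimodl I := (1 : B).

Lemma quot_adjoint_linear (X : rmod C) (Y : rmod B)
    (h : {linear tensor_obj (quot_bimodl I) X -> Y}) :
  linear (fun x : X => h (tpure x quot_one) : inflation_obj (rpi I) Y).
Proof.
move=> c x y; rewrite [tpure _ _]tpureDl linearD; congr (_ + _).
rewrite [tpure (c *: x) _]tpureZl -[RHS]linearZ -tpureZr; congr (h (tpure _ _)).
exact: etrans (mulr1 (rpi I c)) (esym (mul1r (rpi I c))).
Qed.
Definition quot_adjoint (X : rmod C) (Y : rmod B) h : {linear X -> inflation_functor (rpi I) Y} :=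
  mklin (@quot_adjoint_linear X Y h).

Lemma quot_tensor_adjoint :
  adjoint (tensor_functor (quot_bimodl I)) (inflation_functor (rpi I)).
Proof.
exists quot_adjoint; split=> [X Y _ _|X X' Y Y' a b h x _ _ _ _]; last first.
  by rewrite /= tensor_map_pure.
apply: inj_surj_bij => [h h' hh'|g].
  apply: tensor_linear_eq => x b.
  have -> : b = (b : B^c) *: quot_one by exact: esym (mul1r (b : B)).
  rewrite [tpure _ _]tpureZr !linearZ; congr (_ *: _).
  exact: (congr1 (fun k : {linear X -> inflation_functor (rpi I) Y} => k x) hh').
have [||h hE] := @tensor_linear _ _ X (quot_bimodl I) Y (fun x b => (b : B^c) *: (g x : Y)).
- split=> [x x' b|x b b'|x c b].
  + by rewrite linearD; exact: scalerDr.
  + exact: scalerDl.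
  rewrite linearZ; exact: scalerA.
- by move=> x r b; rewrite scalerA.
exists h; apply: linear_ext => x /=; rewrite hE; exact: scale1r.
Qed.

Lemma quot_coadjoint_linear (X : rmod B) (Y : rmod C)
    (h : {linear inflation_obj (rpi I) X -> Y}) (x : X) :
  linear (fun b : inflation_obj (rpi I) (regular_rmod B) => h ((b : B^c) *: x)).
Proof.
move=> c a b; rewrite -linearP; congr (h _).
rewrite scalerDl; congr (_ + _); exact: esym (scalerA (rpi I c : B^c) (a : B^c) x).
Qed.

Lemma quot_coadjoint_linear2 (X : rmod B) (Y : rmod C)
    (h : {linear inflation_obj (rpi I) X -> Y}) :
  linear (fun x : X => mklin (quot_coadjoint_linear h x) : bhom_obj (quot_bimodr I) Y).
Proof.
move=> c x y; apply: linear_ext => b.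
transitivity (h ((b : B^c) *: (c *: x)) + h ((b : B^c) *: y)).
  by rewrite -raddfD; congr (h _); exact: (scalerDr (b : B^c) (c *: x) y).
by congr (_ + _); rewrite scalerA.
Qed.
Definition quot_coadjoint (X : rmod B) (Y : rmod C) h :
    {linear X -> hom_functor (quot_bimodr I) Y} :=
  mklin (@quot_coadjoint_linear2 X Y h).

Lemma quot_hom_adjoint :
  adjoint (inflation_functor (rpi I)) (hom_functor (quot_bimodr I)).
Proof.
exists quot_coadjoint; split=> [X Y _ _|X X' Y Y' a b h x _ _ _ _]; last first.
  by apply: linear_ext => c; rewrite /= /inflation_map linearZ.
apply: inj_surj_bij => [h h' hh'|g].
  apply: linear_ext => x; rewrite -[x](@scale1r B^c X).
  exact: (congr1 (fun k : {linear X -> hom_functor (quot_bimodr I) Y} =>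
    (k x : {linear inflation_obj (rpi I) (regular_rmod B) -> Y}) 1) hh').
pose g0 (x : inflation_obj (rpi I) X) : Y :=
  (g x : {linear inflation_obj (rpi I) (regular_rmod B) -> Y}) (1 : B).
have gZ (c : B) x b :
  (g ((c : B^c) *: x) : {linear inflation_obj (rpi I) (regular_rmod B) -> Y}) b =
  (g x : {linear inflation_obj (rpi I) (regular_rmod B) -> Y}) (c * b) by rewrite linearZ.
have g0L : linear g0.
  move=> c x y; rewrite /g0 linearD; congr (_ + _); rewrite [LHS]gZ -linearZ.
  exact: (congr1 (g x : {linear inflation_obj (rpi I) (regular_rmod B) -> Y})
    (etrans (mulr1 (rpi I c)) (esym (mul1r (rpi I c))))).
exists (mklin g0L); apply: linear_ext => x; apply: linear_ext => b.
by rewrite /= /g0 [LHS]gZ mulr1.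
Qed.

Lemma inflation_full (M N : rmod B)
    (h : {linear inflation_obj (rpi I) M -> inflation_obj (rpi I) N}) :
  linear (h : M -> N).
Proof. by move=> b x y; have [c ->] := rpi_surj b; exact: (linearP h). Qed.

Lemma inflation_fully_faithful : fully_faithful (inflation_functor (rpi I)).
Proof.
move=> M N _ _; exists (fun h => mklin (inflation_full h)) => h; exact: linear_ext.
Qed.

Lemma quot_tensor_fingen : preserves_fingen (tensor_functor (quot_bimodl I)).
Proof.
move=> M; apply: tensor_fingen quot_one _ => d; exists d.
by exact: esym (mul1r (d : B)).
Qed.

Lemma inflation_fingen : preserves_fingen (inflation_functor (rpi I)).
Proof.
move=> M [n [g gE]]; exists n, g => x; have [b bE] := gE x.
have /choice[c cE] i := rpi_surj (b i : B).
by exists c; rewrite bE; apply: eq_bigr => i _; rewrite cE.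
Qed.

Lemma quot_hom_fingen (k : fieldType) (kC : finite_algebra k C) :
  preserves_fingen (hom_functor (quot_bimodr I)).
Proof.
have [kB kBE] := rquot_finite kC I; move=> N; apply: (bhom_fingen (kR := kC) (kS := kB)).
  move=> c b; rewrite kBE; apply: etrans (congr1 ( *%R^~ _) (esym (kBE c))) _.
  exact: etrans (scalC kB c (b : B)) (congr1 _ (kBE c)).
by apply: inflation_fingen; exact: regular_fingen.
Qed.

Section Descent.
Variable N : rmod C.
Hypothesis NI : forall c (n : N), I c -> (c : C^c) *: n = 0.

(** The alias keeps the group of [N] but not its C-action, so that it can receive an action of
    C/I. *)
Definition descent : Type := N.
HB.instance Definition _ := GRing.Zmodule.on descent.

Definition descent_scale (b : B^c) (n : descent) : descent :=
  (zrepr (b : zquot I) : C^c) *: (n : N).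

Lemma descent_scaleE c n : descent_scale (rpi I c) n = (c : C^c) *: (n : N).
Proof.
by apply: subr0_eq; rewrite -scalerBl; apply: NI; exact: (zreprP I c).
Qed.

Lemma descent_scaleA a b n : descent_scale a (descent_scale b n) = descent_scale (a * b) n.
Proof.
have [c ->] := rpi_surj (a : B); have [d ->] := rpi_surj (b : B).
rewrite [descent_scale (rpi I d) n]descent_scaleE [LHS]descent_scaleE scalerA; apply: esym.
apply: etrans (congr1 (descent_scale^~ n) (esym (rmorphM (rpi I) d c))) _.
exact: (descent_scaleE (d * c) n).
Qed.
Lemma descent_scale1 : left_id 1 descent_scale.
Proof.
move=> n; apply: etrans (congr1 (descent_scale^~ n) (esym (rmorph1 (rpi I)))) _.
by rewrite descent_scaleE; exact: scale1r.
Qed.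
Lemma descent_scaleDr : right_distributive descent_scale +%R.
Proof. by move=> b m n; exact: scalerDr. Qed.
Lemma descent_scaleDl n : {morph descent_scale^~ n : a b / a + b}.
Proof.
move=> a b; have [c ->] := rpi_surj (a : B); have [d ->] := rpi_surj (b : B).
apply: etrans (congr1 (descent_scale^~ n) (esym (raddfD (rpi I) c d))) _.
by rewrite !descent_scaleE scalerDl.
Qed.

Definition descent_mod : rmod B :=
  HB.pack_for (lmodType B^c) descent (GRing.Zmodule_isLmodule.Build B^c descent
    descent_scaleA descent_scale1 descent_scaleDr descent_scaleDl).

Lemma descent_iso : iso N (inflation_functor (rpi I) descent_mod).
Proof.
have hL : linear (fun n : N => n : inflation_functor (rpi I) descent_mod).
  by move=> c m n; congr (_ + _); exact: esym (descent_scaleE c m).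
by exists (mklin hL), id.
Qed.

Lemma descent_fingen : fingen N -> fingen descent_mod.
Proof.
move=> [n [g gE]]; exists n, g => x; have [c ->] := gE x.
by exists (fun i => rpi I (c i)); apply: eq_bigr => i _; exact: esym (descent_scaleE _ _).
Qed.
End Descent.
End QuotientFunctors.

(** * The functors of a corner ring *)

Section CornerFunctors.
Variables (A C : pzRingType) (eps : C) (f : corner A eps).

Lemma corner_idem : eps * eps = eps.
Proof. by rewrite -(corner1 f) -cornerM mulr1. Qed.

Definition epsl : epsC f := exist _ eps (introT eqP corner_idem).
Definition epsr : Ceps f := exist _ (eps : regular_rmod C) (introT eqP corner_idem).

Lemma epsl_gen (b : epsC f) : b = (val (b : right_ideal eps) : C^c) *: epsl.
Proof. exact/val_inj/esym/eqP/(valP (b : right_ideal eps)). Qed.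

Lemma epsl_act a : (lact (epsC f) a : endo (epsC f)) epsl = (f a : C^c) *: epsl.
Proof. by apply/val_inj; exact: etrans (corner_mulr1 f a) (esym (corner_mul1r f a)). Qed.

Lemma epsr_act (c : Ceps f) :
  (lact (Ceps f) (val (c : res eps (regular_rmod C)) : C) : endo (Ceps f)) epsr = c.
Proof. exact/val_inj/eqP/(valP (c : res eps (regular_rmod C))). Qed.

Lemma res_tensor_subproof (X : rmod A) (Y : rmod C)
  (h : {linear tensor_obj (epsC f) X -> Y}) x : res_pred eps (h (tpure x epsl)).
Proof.
apply/eqP; rewrite -linearZ -tpureZr; congr (h (tpure _ _)).
exact: esym (epsl_gen epsl).
Qed.

Lemma corner_adjoint_linear (X : rmod A) (Y : rmod C)
    (h : {linear tensor_obj (epsC f) X -> Y}) :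
  linear (fun x : X => exist _ (h (tpure x epsl)) (res_tensor_subproof h x) : res_obj f Y).
Proof.
move=> a x y; apply/val_inj.
change (h (tpure (a *: x + y) epsl) =
  (f a : C^c) *: h (tpure x epsl) + h (tpure y epsl)).
rewrite [tpure _ _]tpureDl linearD; congr (_ + _).
by rewrite [tpure _ _]tpureZl epsl_act -linearZ -tpureZr.
Qed.
Definition corner_adjoint (X : rmod A) (Y : rmod C) h : {linear X -> res_functor f Y} :=
  mklin (@corner_adjoint_linear X Y h).

Lemma corner_tensor_adjoint : adjoint (tensor_functor (epsC f)) (res_functor f).
Proof.
exists corner_adjoint; split=> [X Y _ _|X X' Y Y' a b h x _ _ _ _]; last first.
  by apply/val_inj; rewrite /= tensor_map_pure.
apply: inj_surj_bij => [h h' hh'|g].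
  apply: tensor_linear_eq => x b; rewrite [b]epsl_gen.
  rewrite [tpure _ _]tpureZr !linearZ; congr (_ *: _).
  exact: (congr1 (fun k : {linear X -> res_functor f Y} => val (k x : res eps Y)) hh').
pose g0 (x : X) (b : epsC f) : Y :=
  (val (b : right_ideal eps) : C^c) *: val (g x : res eps Y).
have [||h hE] := @tensor_linear _ _ X (epsC f) Y g0.
- split=> [x x' b|x b b'|x s b]; rewrite /g0.
  + by rewrite linearD; exact: scalerDr.
  + exact: scalerDl.
  by rewrite linearZ; exact: scalerA.
- by move=> x r b; rewrite /g0 scalerA.
exists h; apply: linear_ext => x; apply/val_inj; apply: etrans (hE x epsl) _.
exact/eqP/(valP (g x : res eps Y)).
Qed.

Lemma res_act_subproof (X : rmod C) (x : X) (c : Ceps f) :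
  res_pred eps ((val (c : res eps (regular_rmod C)) : C^c) *: x).
Proof.
apply/eqP; rewrite scalerA; congr (_ *: _).
exact/eqP/(valP (c : res eps (regular_rmod C))).
Qed.
Definition res_act (X : rmod C) (x : X) (c : Ceps f) : res_obj f X :=
  exist _ ((val (c : res eps (regular_rmod C)) : C^c) *: x) (res_act_subproof x c).

Lemma corner_coadjoint_linear (X : rmod C) (Y : rmod A)
  (h : {linear res_obj f X -> Y}) (x : X) : linear (fun c => h (res_act x c)).
Proof.
move=> a c d; rewrite -linearP; congr (h _); apply/val_inj.
apply: etrans (scalerDl _ _ _) _; congr (_ + _).
exact: esym (scalerA (f a : C^c) (val (c : res eps (regular_rmod C)) : C^c) x).
Qed.

Lemma corner_coadjoint_linear2 (X : rmod C) (Y : rmod A) (h : {linear res_obj f X -> Y}) :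
  linear (fun x : X => mklin (corner_coadjoint_linear h x) : bhom_obj (Ceps f) Y).
Proof.
move=> c x y; apply: linear_ext => d.
transitivity (h (res_act (c *: x) d) + h (res_act y d)).
  by rewrite -raddfD; congr (h _); apply/val_inj; exact: scalerDr.
congr (h _ + _); apply/val_inj.
exact: (scalerA (val (d : res eps (regular_rmod C)) : C^c) (c : C^c) x).
Qed.
Definition corner_coadjoint (X : rmod C) (Y : rmod A) h : {linear X -> hom_functor (Ceps f) Y} :=
  mklin (@corner_coadjoint_linear2 X Y h).

Lemma res_act_epsr (X : rmod C) (n : res_obj f X) : res_act (val (n : res eps X)) epsr = n.
Proof. exact/val_inj/eqP/(valP (n : res eps X)). Qed.

Lemma bhom_scaleE (S R : pzRingType) (D : bimod S R) (N : rmod R) (s : S^c)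
    (h : bhom_obj D N) (d : D) :
  ((s *: h : bhom_obj D N) : {linear D -> N}) d =
  (h : {linear D -> N}) ((lact D s : endo D) d).
Proof. by []. Qed.

Lemma corner_hom_adjoint : adjoint (res_functor f) (hom_functor (Ceps f)).
Proof.
exists corner_coadjoint; split=> [X Y _ _|X X' Y Y' a b h x _ _ _ _]; last first.
  apply: linear_ext => c /=; congr (b (h _)); apply/val_inj => /=.
  by rewrite linearZ.
apply: inj_surj_bij => [h h' hh'|g].
  apply: linear_ext => n; rewrite -[n]res_act_epsr.
  exact: (congr1 (fun k : {linear X -> hom_functor (Ceps f) Y} =>
    (k (val (n : res eps X)) : {linear Ceps f -> Y}) epsr) hh').
pose g0 (n : res_obj f X) : Y := (g (val (n : res eps X)) : {linear Ceps f -> Y}) epsr.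
have g0L : linear g0.
  move=> a m n; rewrite /g0 -linearZ.
  have -> : (a *: epsr) = (lact (Ceps f) (f a) : endo (Ceps f)) epsr.
    by apply/val_inj; exact: etrans (corner_mul1r f a) (esym (corner_mulr1 f a)).
  transitivity ((g ((f a : C^c) *: val (m : res eps X) + val (n : res eps X)) :
    {linear Ceps f -> Y}) epsr) => //.
  by rewrite linearD linearZ.
exists (mklin g0L); apply: linear_ext => x; apply: linear_ext => c.
transitivity ((g ((val (c : res eps (regular_rmod C)) : C^c) *: x) :
  {linear Ceps f -> Y}) epsr) => //.
by rewrite linearZ bhom_scaleE epsr_act.
Qed.

Lemma corner_tensor_fingen : preserves_fingen (tensor_functor (epsC f)).
Proof.
move=> M; apply: tensor_fingen epsl _ => b.
by exists (val (b : right_ideal eps)); exact: epsl_gen.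
Qed.

(** The annihilator of [N] is a two-sided ideal. If N eps = 0 it contains eps, hence C eps C, and
    [N] descends to the quotient; conversely eps is zero in the quotient. *)
Lemma res_zeroP (N : rmod C) : let I := ideal_gen (fun x : C => x = eps) in
  fingen N -> zero_module (res_functor f N) <->
  exists2 M : rmod (rquot I), fingen M & iso N (inflation_functor (rpi I) M).
Proof.
move=> I Nf; split=> [N0|[M _ [h [h' hK _]]] n].
  have annc : subgroup_closed (fun c : C => forall n : N, (c : C^c) *: n = 0).
    split=> [n|c d cn dn n]; first exact: scale0r.
    by rewrite (scalerBl (c : C^c) (d : C^c)) cn dn subrr.
  have annl a (c : C) : Subgroup annc c -> Subgroup annc (a * c).
    move=> cn n; rewrite -[LHS]/((c : C^c) * (a : C^c) *: n) -scalerA; exact: cn.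
  have annr a (c : C) : Subgroup annc c -> Subgroup annc (c * a).
    by move=> cn n; rewrite -[LHS]/((a : C^c) * (c : C^c) *: n) -scalerA cn scaler0.
  have NI c (n : N) : I c -> (c : C^c) *: n = 0.
    move=> Ic; apply: (Ic (Ideal annl annr)) => _ -> {}n.
    have en : res_pred eps ((eps : C^c) *: n).
      by apply/eqP; rewrite scalerA; congr (_ *: _); exact: corner_idem.
    exact: (congr1 (fun n' : res_obj f N => val (n' : res eps N))
      (N0 (exist _ ((eps : C^c) *: n) en))).
  exists (descent_mod NI); first exact: descent_fingen.
  exact: descent_iso.
have rpi0 : rpi I eps = 0 by apply/zpi_eq0 => J; apply.
apply/val_inj; apply: (can_inj hK); apply: etrans _ (esym (raddf0 h)).
rewrite -(eqP (valP (n : res eps N))) linearZ.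
rewrite -[LHS]/((rpi I eps : (rquot I)^c) *: (h (val (n : res eps N)) : M)).
rewrite rpi0; exact: (@scale0r (rquot I)^c M).
Qed.
End CornerFunctors.

Section CornerRecollement.
Variables (A C : pzRingType) (eps : C) (f : corner A eps).
Hypothesis fI : injective f.
Hypothesis fE : forall x : C, (exists a, f a = x) <-> eps * x * eps = x.

(** The compression x -> eps x eps, read back in A through the injective [f]. It need not be
    multiplicative, but it is A-linear on both sides, which suffices to invert the unit and the
    counit below. *)
Lemma corner_retraction : exists g : C -> A,
  [/\ forall x, f (g x) = eps * x * eps, g eps = 1, {morph g : x y / x + y},
      forall a x, g (f a * x) = a * g x & forall x a, g (x * f a) = g x * a].
Proof.
have /choice[g gE] x : exists a, f a = eps * x * eps.
  by apply/fE; rewrite !mulrA (corner_idem f) -!mulrA (corner_idem f).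
exists g; split=> // [|x y|a x|x a]; apply: fI.
- by rewrite gE !(corner_idem f) corner1.
- by rewrite raddfD !gE mulrDr mulrDl.
- by rewrite cornerM !gE !mulrA corner_mul1r corner_mulr1.
by rewrite cornerM !gE -!mulrA corner_mul1r corner_mulr1.
Qed.

(** The map [rho], n (x) b -> n g(b), inverts the unit n -> n (x) eps: it satisfies rho(n (x) eps) =
    n and rho(u) (x) eps = u eps. A C-linear [h] is thus determined by x -> rho(h(x (x) eps)). *)
Lemma corner_tensor_fully_faithful : fully_faithful (tensor_functor (epsC f)).
Proof.
have [g [gE geps gD gMl gMr]] := corner_retraction.
pose rho0 (N : rmod A) (n : N) (b : epsC f) : N := (g (val (b : right_ideal eps)) : A^c) *: n.
have rhob N : balanced (@rho0 N).
  split=> [m m' b|m b b'|m s b]; rewrite /rho0 ?scalerDr ?scalerA //.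
    by rewrite [g _]gD; exact: scalerDl.
  by congr (_ *: _); exact: esym (gMl s _).
have [rho [rhoB rhoP]] : exists rho : forall N : rmod A, tensor_obj (epsC f) N -> N,
    (forall N, zmod_morphism (rho N)) /\
    (forall N n b, rho N (tpure n b) = rho0 N n b).
  by exists (fun N => tlift (@rho0 N)); split=> N *; [exact: tliftB | exact: tlift_pure].
have rhoZ N a u : rho N ((f a : C^c) *: u) = (a : A^c) *: rho N u.
  move: u; apply: (@tensor_ext _ _ N (epsC f)) => [u v|u v|n b].
  - by rewrite scalerBr rhoB.
  - by rewrite rhoB scalerBr.
  apply: etrans (congr1 (rho N) (esym (tpureZr n (f a : C^c) b))) _.
  apply: etrans (rhoP _ _ _) _; apply: etrans _ (esym (congr1 ( *:%R (a : A^c)) (rhoP N n b))).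
  apply: etrans _ (esym (scalerA _ _ _)).
  exact: (congr1 (fun x : A^c => x *: n) (gMr _ a)).
have rhoeps N n : rho N (tpure n (epsl f)) = n.
  by rewrite rhoP /rho0 [g _]geps; exact: scale1r.
have rhoK N u : tpure (rho N u) (epsl f) = (eps : C^c) *: u :> tensor_obj (epsC f) N.
  move: u; apply: (@tensor_ext _ _ N (epsC f)) => [u v|u v|n b].
  - have tB : zmod_morphism (fun n => tpure n (epsl f) : tensor_obj (epsC f) N).
      by apply: additive_zmod_morphism => x y; exact: tpureDl.
    by rewrite rhoB [LHS]tB.
  - exact: scalerBr.
  rewrite rhoP -[RHS]tpureZr [LHS]tpureZl epsl_act; congr (tpure _ _); apply/val_inj.
  rewrite -[LHS]/(eps * f (g (val (b : right_ideal eps)))) gE !mulrA (corner_idem f).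
  by congr (_ * _); exact/eqP/(valP (b : right_ideal eps)).
move=> M N _ _; apply: inj_surj_bij => [f1 f2 f12|h].
  apply: linear_ext => x; rewrite -[LHS]rhoeps -[RHS]rhoeps -!tensor_map_pure.
  by have := congr1 (fun h : {linear tensor_obj (epsC f) M -> tensor_obj (epsC f) N} =>
    rho N (h (tpure x (epsl f)))) f12.
pose f0 x := rho N (h (tpure x (epsl f))).
have f0L : linear f0.
  apply: zmod_scalable_linear.
    apply: additive_zmod_morphism => x y; rewrite /f0 [tpure _ _]tpureDl linearD.
    exact: (raddfD (mkadd (rhoB N))).
  by move=> a x; rewrite /f0 [tpure _ _]tpureZl epsl_act tpureZr linearZ; exact: rhoZ.
exists (mklin f0L); apply: tensor_linear_eq => x b; rewrite [b]epsl_gen.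
rewrite [tpure _ _]tpureZr !linearZ; congr (_ *: _).
rewrite [LHS]tensor_map_pure [LHS]rhoK -linearZ -tpureZr.
by congr (h (tpure _ _)); exact: esym (epsl_gen (epsl f)).
Qed.

(** Dually, [th m], the map c -> m g(c), inverts evaluation at eps. The identity [thE], th(phi(c)) =
    phi c, reduces a C-linear [h] to its values on the maps [th m]. *)
Lemma corner_hom_fully_faithful : fully_faithful (hom_functor (Ceps f)).
Proof.
have [g [gE geps gD gMl gMr]] := corner_retraction.
pose v (c : Ceps f) : C := val (c : res eps (regular_rmod C)).
have veps c : v c * eps = v c by exact/eqP/(valP (c : res eps (regular_rmod C))).
have thL (M : rmod A) (m : M) : linear (fun c : Ceps f => (g (v c) : A^c) *: m).
  move=> a c d; rewrite -[v _]/(v c * f a + v d) gD gMr.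
  by apply: etrans (scalerDl _ _ _) _; congr (_ + _); exact: esym (scalerA _ _ _).
pose th M m : bhom_obj (Ceps f) M := mklin (thL M m).
have thD (M : rmod A) (m m' : M) : th M (m + m') = th M m + th M m'.
  by apply: linear_ext => c; exact: scalerDr.
have thZ (M : rmod A) (a : A^c) (m : M) : th M (a *: m) = (f a : C^c) *: th M m.
  apply: linear_ext => c; rewrite bhom_scaleE -[RHS]/((g (f a * v c) : A^c) *: m) gMl.
  exact: scalerA.
have theps (M : rmod A) (m : M) : (th M m : {linear Ceps f -> M}) (epsr f) = m.
  by rewrite -[LHS]/((g eps : A^c) *: m) geps; exact: scale1r.
have thE (M : rmod A) (phi : bhom_obj (Ceps f) M) c :
    th M ((phi : {linear Ceps f -> M}) c) = (v c : C^c) *: phi.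
  apply: linear_ext => d; rewrite bhom_scaleE -[LHS]/(_ *: _) -linearZ; congr (phi _).
  apply/val_inj; rewrite -[LHS]/(v c * f (g (v d))) gE -[eps * _ * eps]mulrA veps.
  by rewrite mulrA veps.
move=> M N _ _; apply: inj_surj_bij => [f1 f2 f12|h].
  apply: linear_ext => m; rewrite -[m]theps.
  exact: (congr1 (fun h : {linear bhom_obj (Ceps f) M -> bhom_obj (Ceps f) N} =>
    (h (th M m) : {linear Ceps f -> N}) (epsr f)) f12).
pose f0 m : N := (h (th M m) : {linear Ceps f -> N}) (epsr f).
have f0L : linear f0.
  move=> a m m'; rewrite /f0 thD thZ linearD linearZ -[LHS]/(_ + _); congr (_ + _).
  rewrite [LHS]bhom_scaleE -linearZ; congr ((h _ : {linear Ceps f -> N}) _).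
  by apply/val_inj; exact: etrans (corner_mulr1 f a) (esym (corner_mul1r f a)).
exists (mklin f0L); apply: linear_ext => phi; apply: linear_ext => c.
rewrite -[LHS]/(f0 ((phi : {linear Ceps f -> M}) c)) /f0 thE linearZ bhom_scaleE.
by rewrite epsr_act.
Qed.

Variables (k : fieldType) (kA : finite_algebra k A) (kC : finite_algebra k C).
(** Compatibility of the two k-structures; the factor [eps] appears because [f] sends 1 to [eps]. *)
Hypothesis kf : forall c, f (kA c) = kC c * eps.

Lemma corner_res_fingen : preserves_fingen (res_functor f).
Proof.
move=> M /(kmod_fingen kC) Mf; apply/(kmod_fingen kA).
have vL : linear (fun n : kmod kA (res_functor f M) =>
    val (n : res eps M) : kmod kC M).
  move=> c m n; congr (_ + _).
  rewrite -[LHS]/((f (kA c) : C^c) *: (val (m : res eps M))) kf scalC.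
  rewrite -[in RHS](eqP (valP (m : res eps M))).
  exact: esym (scalerA (kC c : C^c) (eps : C^c) (val (m : res eps M))).
exact: (field_noetherian (f := mklin vL)) val_inj Mf.
Qed.

Lemma corner_hom_fingen : preserves_fingen (hom_functor (Ceps f)).
Proof.
move=> N; apply: (bhom_fingen (kR := kA) (kS := kC)).
  move=> c x; apply/val_inj.
  rewrite -[RHS]/((val (x : res eps (regular_rmod C)) : C) * f (kA c)) kf mulrA -scalC -mulrA.
  congr (_ * _); exact/esym/eqP/(valP (x : res eps (regular_rmod C))).
by apply: corner_res_fingen; exact: regular_fingen.
Qed.

Lemma corner_recollement : standard_recollement f.
Proof.
split.
- split; [exact: quot_tensor_fingen|exact: inflation_fingen|exact: quot_hom_fingen kC].
- by split; [exact: corner_tensor_fingen|exact: corner_res_fingen|exact: corner_hom_fingen].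
- split; [exact: quot_tensor_adjoint|exact: quot_hom_adjoint|
          exact: corner_tensor_adjoint|exact: corner_hom_adjoint].
- split; [exact: inflation_fully_faithful|exact: corner_tensor_fully_faithful|
          exact: corner_hom_fully_faithful].
exact: res_zeroP.
Qed.
End CornerRecollement.

(** * The endomorphism algebra *)

Section DirectSums.
Variables (R : pzRingType) (I : finType) (X : I -> rmod R).

Definition dsum_in_fun i (x : X i) : dsum X := fun j =>
  if @eqP I i j is ReflectT ij then eq_rect i (fun j => X j : Type) x j ij else 0.

Lemma dsum_in_same i x : @dsum_in_fun i x i = x.
Proof. by rewrite /dsum_in_fun; case: eqP => // ii; rewrite (eq_axiomK ii). Qed.

Lemma dsum_in_other i j x : i != j -> @dsum_in_fun i x j = 0.
Proof. by rewrite /dsum_in_fun; case: eqP. Qed.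

Lemma dsum_in_linear i : linear (@dsum_in_fun i).
Proof.
move=> r x y; apply: dsum_ext => j.
rewrite -[RHS]/(r *: dsum_in_fun x j + dsum_in_fun y j).
have [<-|ij] := eqVneq i j; first by rewrite !dsum_in_same.
by rewrite !dsum_in_other // scaler0 addr0.
Qed.
Definition dsum_in i : {linear X i -> dsum X} := mklin (@dsum_in_linear i).

Lemma dsum_at_linear i : linear (fun x : dsum X => x i).
Proof. by []. Qed.
Definition dsum_at i : {linear dsum X -> X i} := mklin (dsum_at_linear i).

Lemma dsum_inK i x : dsum_at i (dsum_in i x) = x.
Proof. exact: dsum_in_same. Qed.

Lemma dsum_projE i (x : dsum X) : dsum_proj i x = dsum_in i (x i).
Proof.
apply: dsum_ext => j; rewrite /dsum_proj /=.
have [->|ij] := eqVneq j i; first by rewrite dsum_in_same.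
by rewrite dsum_in_other // eq_sym.
Qed.

Lemma dsum_sum (x : dsum X) : x = \sum_i dsum_in i (x i).
Proof.
apply: dsum_ext => j; rewrite -[RHS]/(dsum_at j _) linear_sum (bigD1 j) //= dsum_in_same.
by rewrite big1 ?addr0 // => i ij; rewrite dsum_in_other.
Qed.

Lemma dsum_fingen : (forall i, fingen (X i)) -> fingen (dsum X).
Proof.
move=> Xf; pose n i := projT1 (cid (Xf i)).
pose g i : 'I_(n i) -> X i := projT1 (cid (projT2 (cid (Xf i)))).
have gE i x : exists c : 'I_(n i) -> R, x = \sum_j (c j : R^c) *: g i j :=
  projT2 (cid (projT2 (cid (Xf i)))) x.
apply: (fingen_fin (g := fun p : {i : I & 'I_(n i)} => dsum_in (tag p) (g _ (tagged p)))) => x.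
pose c i := projT1 (cid (gE i (x i))).
have cE i : x i = \sum_j (c i j : R^c) *: g i j := projT2 (cid (gE i (x i))).
exists (fun p => c (tag p) (tagged p)).
rewrite [LHS]dsum_sum; under eq_bigr => i _ do rewrite cE linear_sum.
rewrite sig_big_dep; apply: eq_bigr => p _.
exact: (linearZ_LR (dsum_in (tag p))).
Qed.
End DirectSums.
Arguments dsum_in {R I} X i.
Arguments dsum_at {R I} X i.

Lemma regular_projective (S : pzRingType) : projective (S^o : lmodType S).
Proof.
move=> M N p f pS; have [m mE] := pS (f 1).
have gL : linear (fun t : S^o => (t : S) *: m).
  by move=> s t u; rewrite scalerDl -scalerA.
by exists (mklin gL) => t; rewrite linearZ /= mE -linearZ /= [_ *: _]mulr1.
Qed.

(** A Gorenstein-projective embeds in a finitely generated projective, whose dual basis separates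
    points. *)
Lemma gp_torsionless (R : pzRingType) (G : rmod R) (u : G) : gorenstein_projective G ->
  (forall h : {linear G -> regular_rmod R}, h u = 0) -> u = 0.
Proof.
move=> [P [d [[Pf Pp _ _] [i [j [jI _]]]]]] hu; apply: jI; rewrite raddf0.
have [n [g [l lE]]] := dual_basis (conj (Pf (i + 1)) (Pp (i + 1))).
rewrite [LHS]lE big1 // => m _.
by rewrite [l m _](hu (l m \o j : {linear G -> regular_rmod R})) scale0r.
Qed.

Section CMAlgebra.
Variables (A : pzRingType) (V : finType) (e : cidem A V).
Variables (J : finType) (G : J -> rmod A).
Local Notation fam := (gp_family e G).
Local Notation M := (dsum fam).
Local Notation C := (CMA e G).
Local Notation eps := (cma_eps e G).
Local Notation f := (cma_corner e G).
Local Notation total := (@cma_total A V e J G).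
Implicit Types (a t : A) (m : M) (c : C).

Lemma vertex_gen_subproof v : right_ideal_pred (e v) (e v).
Proof. by apply/eqP; rewrite cidemM eqxx. Qed.

(** The element 1 of A, placed in M through the decomposition of A into the e_v A. With [total] as
    the projection of M to A, the idempotent eps is m -> cma_gen . total m. *)
Definition cma_gen : M := fun i => match i return fam i with
  | inl v => exist _ (e v : regular_rmod A) (vertex_gen_subproof v)
  | inr j => 0
  end.

Lemma total_gen : total cma_gen = 1.
Proof. exact: cidem1. Qed.

Lemma cma_mapE a m : (cma_map e G a : {linear M -> M}) m = (a * total m : A^c) *: cma_gen.
Proof.
apply: dsum_ext => -[v|j]; first exact/val_inj.
by apply: esym; exact: scaler0.
Qed.

Lemma cma_epsE m : (eps : {linear M -> M}) m = (total m : A^c) *: cma_gen.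
Proof. by rewrite -cma_map1 cma_mapE mul1r. Qed.

Lemma total_linear : linear (total : M -> regular_rmod A).
Proof. move=> a m n; exact (cma_total_linear a m n). Qed.

Lemma totalZ t m : total ((t : A^c) *: m) = total m * t.
Proof. exact: (linearZ_LR (mklin total_linear)). Qed.

Lemma cma_corner_inj : injective f.
Proof.
move=> a b ab; have := congr1 (fun c => total ((c : {linear M -> M}) cma_gen)) ab.
by rewrite /= !cma_total_left total_gen !mulr1.
Qed.

Lemma cma_corner_image (x : C) : (exists a, f a = x) <-> eps * x * eps = x.
Proof.
split=> [[a <-]|<-]; first by rewrite corner_mul1r corner_mulr1.
(* An element of eps C eps is an endomorphism of the right module A, that is, left multiplication by
   its value at 1. *)
exists (total ((x : {linear M -> M}) cma_gen)); apply: linear_ext => m.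
rewrite [LHS]cma_mapE.
rewrite -[RHS]/((eps : {linear M -> M}) ((x : {linear M -> M}) ((eps : {linear M -> M}) m))).
by rewrite !cma_epsE linearZ totalZ.
Qed.

Lemma cma_fingen : (forall i, gorenstein_projective (fam i)) -> fingen M.
Proof. by move=> gp; apply: dsum_fingen => i; exact: gp_fingen. Qed.

Lemma cma_finite (k : fieldType) (kA : finite_algebra k A) :
  (forall i, gorenstein_projective (fam i)) ->
  exists kC : finite_algebra k C, forall s, f (kA s) = kC s * eps.
Proof.
move=> gp; have [kC kCE] := endo_finite kA (cma_fingen gp); exists kC => s.
apply: linear_ext => m; rewrite [LHS]cma_mapE.
rewrite -[RHS]/((kC s : endo M) ((eps : {linear M -> M}) m)) kCE cma_epsE scalerA.
by rewrite scalC.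
Qed.

Lemma cma_idemE i m : (cma_idem e G i : {linear M -> M}) m = dsum_in fam i (m i).
Proof. exact: dsum_projE. Qed.

Lemma gen_map_linear i (y : fam i) :
  linear (fun m => (total m : A^c) *: dsum_in fam i y).
Proof.
move=> a m n; rewrite cma_total_linear scalerA.
exact: (scalerDl _ (total m * (a : A) : A^c) (total n : A^c)).
Qed.

Lemma res_idem_iso i :
  iso (res_functor f (right_ideal_rmod (cma_idem e G i))) (fam i).
Proof.
pose N := right_ideal_rmod (cma_idem e G i).
pose elt (x : res_obj f N) : C := val (val (x : res eps N) : right_ideal (cma_idem e G i)).
have elt_idem x : cma_idem e G i * elt x = elt x.
  exact/eqP/(valP (val (x : res eps N) : right_ideal (cma_idem e G i))).
have elt_eps x : elt x * eps = elt x.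
  exact: (congr1 val (eqP (valP (x : res eps N)))).
(* Being fixed by eps on the right and by the i-th idempotent on the left, the map is determined by
   the i-th component of its value at [cma_gen]. *)
have eltE x m : (elt x : {linear M -> M}) m =
    (total m : A^c) *: dsum_in fam i ((elt x : {linear M -> M}) cma_gen i).
  rewrite -{1}elt_eps -[LHS]/((elt x : {linear M -> M}) ((eps : {linear M -> M}) m)).
  by rewrite cma_epsE linearZ -{1}elt_idem -cma_idemE.
have FL : linear (fun x : res_obj f N => (elt x : {linear M -> M}) cma_gen i : fam i).
  move=> a x y.
  rewrite -[LHS]/(((elt x : {linear M -> M}) ((f a : {linear M -> M}) cma_gen) +
    (elt y : {linear M -> M}) cma_gen) i).
  by rewrite [(f a : {linear M -> M}) _]cma_mapE total_gen mulr1 linearZ.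
exists (mklin FL); apply: inj_surj_bij => [x y xy|y].
  do 2!apply/val_inj; apply: linear_ext => m; apply: etrans (eltE x m) _.
  by apply: etrans _ (esym (eltE y m)); congr (_ *: dsum_in _ _ _).
(* The composite M -> A -> M_i -> M whose middle map sends 1 to [y]. *)
pose c : C := mklin (gen_map_linear y).
have c_idem : right_ideal_pred (cma_idem e G i) c.
  apply/eqP; apply: linear_ext => m.
  rewrite -[LHS]/((cma_idem e G i : {linear M -> M}) ((c : {linear M -> M}) m)) cma_idemE.
  have -> : (c : {linear M -> M}) m i = (total m : A^c) *: y.
    by rewrite -[LHS]/((total m : A^c) *: dsum_in_fun y i) dsum_in_same.
  by rewrite linearZ.
pose n : N := exist _ (c : regular_rmod C) c_idem.
have neps : res_pred eps n.
  apply/eqP/val_inj; apply: linear_ext => m.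
  rewrite -[LHS]/((c : {linear M -> M}) ((eps : {linear M -> M}) m)) cma_epsE linearZ.
  rewrite -[(c : {linear M -> M}) cma_gen]/((total cma_gen : A^c) *: dsum_in fam i y).
  by rewrite total_gen scale1r.
exists (exist _ n neps).
by rewrite -[LHS]/((total cma_gen : A^c) *: dsum_in_fun y i) total_gen scale1r dsum_in_same.
Qed.
End CMAlgebra.

(** * Induced modules are not torsionless *)

Section TensorNotTorsionless.
Variables (A : pzRingType) (V : finType) (e : cidem A V).
Variables (J : finType) (G : J -> rmod A).
Local Notation fam := (gp_family e G).
Local Notation M := (dsum fam).
Local Notation C := (CMA e G).
Local Notation eps := (cma_eps e G).
Local Notation f := (cma_corner e G).
Local Notation total := (@cma_total A V e J G).
Local Notation app c m := ((c : {linear M -> M}) m).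
Variable X : rmod A.
Local Notation T := (tensor_obj (epsC f) X).
Local Notation coef b := (val (b : right_ideal eps) : C).

(** The canonical map from X (x) Hom(M, A) to Hom(M, X), evaluated at [m]; [total] turns the
    endomorphism [coef b], whose image lies in the summand A, into a map M -> A. *)
Definition eval_pure (m : M) (x : X) (b : epsC f) : X := (total (app (coef b) m) : A^c) *: x.

Lemma totalD (m n : M) : total (m + n) = total m + total n.
Proof. exact: (raddfD (mklin (@total_linear A V e J G))). Qed.

Lemma eval_balanced m : balanced (eval_pure m).
Proof.
split=> [x x' b|x b b'|x s b]; rewrite /eval_pure ?scalerDr //.
  apply: etrans _ (scalerDl x (_ : A^c) (_ : A^c)).
  exact: (congr1 (fun t : A^c => t *: x) (totalD (app (coef b) m) (app (coef b') m))).
rewrite scalerA; congr (_ *: _); apply: esym.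
exact: (@cma_total_left A V e J G s).
Qed.

Definition tensor_eval (m : M) : {additive T -> X} := mkadd (tliftB (eval_balanced m)).

Lemma tensor_eval_pure m x b : tensor_eval m (tpure x b) = eval_pure m x b.
Proof. exact: (tlift_pure (eval_balanced m)). Qed.

(** Put t = total(b m), so that b m = cma_gen . t. Then h(x (x) b)(m) = h(x (x) eps)(cma_gen . t) =
    h(x t (x) eps)(cma_gen), and x t is the evaluation of x (x) b at m. Hence h(u)(m) depends
    additively on the evaluation of u at m alone. *)
Lemma eval_zero_functional (h : {linear T -> regular_rmod C}) u :
  (forall m, tensor_eval m u = 0) -> h u = 0.
Proof.
move=> u0; pose eta (x : X) : M := app (h (tpure x (epsl f)) : C) (cma_gen e G).
have etaB : zmod_morphism eta.
  by apply: additive_zmod_morphism => x y; rewrite /eta [tpure _ _]tpureDl linearD.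
suff hE m : app (h u : C) m = eta (tensor_eval m u).
  by apply: linear_ext => m; rewrite hE u0; exact: (raddf0 (mkadd etaB)).
move: u {u0}; apply: (@tensor_ext _ _ X (epsC f) M
  (fun u : T => app (h u : C) m) (fun u => eta (tensor_eval m u))) => [u v|u v|x b].
- by rewrite (linearB h).
- by rewrite raddfB etaB.
rewrite tensor_eval_pure /eval_pure; set t := total _.
have bE : app (coef b) m = (t : A^c) *: cma_gen e G.
  rewrite -cma_epsE -[RHS]/(app (eps * coef b) m); congr (app (_ : C) m).
  exact/esym/eqP/(valP (b : right_ideal eps)).
rewrite [b in LHS]epsl_gen tpureZr linearZ.
rewrite -[LHS]/(app (h (tpure x (epsl f)) : C) (app (coef b) m)) bE linearZ.
rewrite /eta [tpure ((t : A^c) *: x) _]tpureZl epsl_act tpureZr linearZ.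
rewrite -[RHS]/(app (h (tpure x (epsl f)) : C) (app (f t) (cma_gen e G))).
by rewrite [app (f t) _]cma_mapE total_gen mulr1 linearZ.
Qed.

Variables (H P : rmod A) (a : {linear H -> P}) (b : {linear P -> X}).
Hypothesis ab : frobenius a b.
Variables (i : V + J) (s : {linear fam i -> H}).

(** The classes live in Hom(M_i, P) and not in Hom(M_i, H), because the map attached to a single
    pure tensor has values in P only. As [a] is injective, Hom(M_i, H) modulo maps through
    projectives still embeds in the quotient. *)
Definition through_projective (h : lhom (fam i) P) : Prop :=
  exists (F : rmod A) (al : {linear fam i -> F}) (be : {linear F -> H}),
    projective F /\ forall m, h m = a (be (al m)).

Lemma through_projective_closed : subgroup_closed through_projective.
Proof.
split=> [|h h' [F [al [be [Fp hE]]]] [F' [al' [be' [Fp' hE']]]]].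
  exists (regular_rmod A), (\0 : {linear fam i -> regular_rmod A}),
    (\0 : {linear regular_rmod A -> H}).
  by split=> [|m]; [exact: regular_projective | rewrite /= raddf0].
exists (F * F')%type, (lin_pair al al'), (lin_copair be (\- be' : {linear F' -> H})).
split=> [|m]; first exact: projective_prod.
by rewrite -[LHS]/(h m - h' m) hE hE' -raddfB.
Qed.
Local Notation TP := (Subgroup through_projective_closed).

Lemma act_total_linear (p : P) (c : C) :
  linear (fun m : fam i => (total (app c (dsum_in fam i m)) : A^c) *: p).
Proof.
move=> r m n; rewrite !linearP cma_total_linear scalerA.
exact: (scalerDl p (_ * (r : A) : A^c) (_ : A^c)).
Qed.
Definition act_total p c : lhom (fam i) P := mklin (act_total_linear p c).

(** Two lifts of one element of X differ by some a(h), and the maps they define differ by M_i -> A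
    -> H -> P, where the middle map is t -> h t. So the class does not depend on the lift. *)
Lemma act_total_eq p p' c : b p = b p' -> zpi TP (act_total p c) = zpi TP (act_total p' c).
Proof.
move=> pp'; have [_ _ abE _ _] := ab.
have /abE[h hE] : b (p - p') = 0 by rewrite raddfB /= pp' subrr.
have alL : linear (fun m : fam i => total (app c (dsum_in fam i m)) : regular_rmod A).
  by move=> r m n; rewrite !linearP cma_total_linear.
have beL : linear (fun t : regular_rmod A => (t : A^c) *: h).
  by move=> r t t'; rewrite scalerDl; congr (_ + _); exact: esym (scalerA _ _ _).
apply/zpi_eq; exists (regular_rmod A), (mklin alL), (mklin beL).
split=> [|m]; first exact: regular_projective.
by rewrite -[LHS]/(_ *: p - _ *: p') -scalerBr -hE /= linearZ.
Qed.

(* With [c : X -> P] a set-theoretic section, [x (x) b] is sent to the class of the map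
   [m |-> (b m) x~] with [x~] a lift of [x] to [P]; the element built below has all its
   evaluations zero, but is sent to the class of [a \o s]. *)
Lemma torsionless_through_projective :
  (forall u : T, (forall m, tensor_eval m u = 0) -> u = 0) ->
  exists (F : rmod A) (al : {linear fam i -> F}) (be : {linear F -> H}),
    projective F /\ forall m, s m = be (al m).
Proof.
move=> T0; have [Pp aI abE bS _] := ab.
have [c cE] := choice bS.
have ba x : b (a x) = 0 by apply/abE; exists x.
pose th0 (x : X) (y : epsC f) := zpi TP (act_total (c x) (coef y)).
have thb : balanced th0.
  split=> [x x' y|x y y'|x r y]; rewrite /th0.
  - have -> : zpi TP (act_total (c (x + x')) (coef y)) = zpi TP (act_total (c x + c x') (coef y)).
      by apply: act_total_eq; rewrite raddfD /= !cE.
    by rewrite -raddfD; congr (zpi TP _); apply: linear_ext => m; exact: scalerDr.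
  - rewrite -raddfD; congr (zpi TP _); apply: linear_ext => m.
    apply: etrans (congr1 (fun t : A^c => t *: c x) (totalD _ _)) _; exact: scalerDl.
  have -> : zpi TP (act_total (c ((r : A^c) *: x)) (coef y)) =
      zpi TP (act_total ((r : A^c) *: c x) (coef y)).
    by apply: act_total_eq; rewrite linearZ /= !cE.
  congr (zpi TP _); apply: linear_ext => m; apply: etrans (scalerA _ _ _) _.
  congr (_ *: _); apply: esym; exact: (@cma_total_left A V e J G r).
pose Th := mkadd (tliftB thb).
have ThP x y : Th (tpure x y) = th0 x y by exact: (tlift_pure thb).
have [n [g [l lE]]] := dual_basis Pp.
(* The j-th coordinate of [a \o s] as an element of eps C: the composite M -> M_i -> H -> P -> A ->
   M. *)
have yL j : linear (fun m : M => (l j (a (s (dsum_at fam i m))) : A^c) *: cma_gen e G).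
  move=> r m m'; rewrite !linearP scalerA.
  exact: (scalerDl _ ((r : A^c) * (l j _ : A^c)) (l j _ : A^c)).
pose y0 j : C := mklin (yL j).
have epsy j : right_ideal_pred eps (y0 j).
  apply/eqP; apply: linear_ext => m.
  by rewrite -[LHS]/(app eps (app (y0 j) m)) cma_epsE totalZ total_gen mul1r.
pose y j : epsC f := exist _ (y0 j : regular_rmod C) (epsy j).
have ty j m : total (app (y0 j) m) = l j (a (s (dsum_at fam i m))).
  by rewrite totalZ total_gen mul1r.
(* By the dual basis, the evaluation of this element at [m] is b(a(s(m_i))), which is zero since
   [b \o a] is. *)
have u0 : \sum_j tpure (b (g j)) (y j) = 0 :> T.
  apply: T0 => m; rewrite raddf_sum.
  rewrite -[RHS](ba (s (dsum_at fam i m))) [in RHS](lE (a _)) linear_sum.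
  apply: eq_bigr => j _; rewrite tensor_eval_pure linearZ.
  exact: (congr1 (fun t : A^c => t *: b (g j)) (ty j m)).
(* Once the chosen lift of b(g_j) is replaced by [g j] itself, the image of the element is the class
   of the dual basis expansion of [a \o s]. *)
have : zpi TP (a \o s : {linear fam i -> P}) = 0.
  rewrite -(raddf0 Th) -u0 raddf_sum.
  have -> : (a \o s : {linear fam i -> P}) = \sum_j act_total (g j) (y0 j) :> lhom (fam i) P.
    apply: linear_ext => m.
    have evB : zmod_morphism (fun h : lhom (fam i) P => h m) by [].
    rewrite -[RHS]/(mkadd evB _) raddf_sum [LHS]/= [LHS]lE; apply: eq_bigr => j _.
    rewrite -[RHS]/((total (app (y0 j) (dsum_in fam i m)) : A^c) *: g j) ty.
    by rewrite dsum_inK.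
  rewrite raddf_sum; apply: eq_bigr => j _; rewrite ThP /th0.
  by apply: act_total_eq; rewrite cE.
move=> /zpi_eq0[F [al [be [Fp hE]]]]; exists F, al, be; split=> // m.
exact/aI/(hE m).
Qed.
End TensorNotTorsionless.

(** If [H] were projective, its identity would extend along [a] by [extends_to_fgproj]; the sequence
    would split and [X] would be a summand of [P]. *)
Lemma frobenius_nonprojective (R : pzRingType) (X H P : lmodType R)
    (a : {linear H -> P}) (b : {linear P -> X}) :
  frobenius a b -> fingen H -> ~ projective X -> ~ projective H.
Proof.
move=> ab Hf Xp Hp; have [Pp aI abE bS aE] := ab; apply: Xp.
have [r rE] := extends_to_fgproj aE (conj Hf Hp) (idfun : {linear H -> H}).
have [|t tE] := factor_surj (b := b) (g := idfun \- (a \o r) : {linear P -> P}) bS.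
  by move=> p /abE[x <-] /=; rewrite rE subrr.
apply: (projective_retract (s := t) (r := b)) (proj2 Pp) => x.
have [p <-] := bS x; rewrite tE /= raddfB /=.
have /abE-> : exists x, a x = a (r p) by exists (r p).
exact: subr0.
Qed.

Lemma cma_tensor_not_gp (k : fieldType) (A : pzRingType) (kA : finite_algebra k A)
    (V : finType) (e : cidem A V) (J : finType) (G : J -> rmod A) :
  gp_complete e G -> forall X : rmod A,
  gorenstein_projective X -> ~ projective X ->
  ~ gorenstein_projective (tensor_functor (epsC (cma_corner e G)) X).
Proof.
move=> [_ _ all] X Xgp Xp Tgp.
have noeth := finite_algebra_noetherian kA.
have approx := finite_algebra_approximations kA.
have [H [P [a [b [Hgp ab]]]]] := gp_syzygy Xgp.
have Hp := frobenius_nonprojective ab (gp_fingen Hgp) Xp.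
have [Y [[s [r rs]] Yi Yp]] := indecomposable_nonprojective_retract kA (gp_fingen Hgp) Hp.
have Ygp : gorenstein_projective Y.
  by apply: (gp_retract noeth approx Hgp); exists s, r.
have [i [phi [phi' phiK phi'K]]] := all Y Yi Ygp.
have [|F [al [be [Fp sE]]]] := torsionless_through_projective ab
  (s \o mklin (inv_linear phiK phi'K) : {linear gp_family e G i -> H}).
  move=> u u0; apply: (gp_torsionless Tgp) => h; exact: eval_zero_functional.
(* The factorization of Y -> M_i -> H through [F], followed by the retraction of [H] onto [Y],
   exhibits [Y] as a summand of the projective [F]. *)
apply: Yp; apply: (projective_retract (s := al \o phi : {linear Y -> F})
  (r := r \o be : {linear F -> Y})) Fp => y /=.
by rewrite -sE /= phiK rs.
Qed.

(* A = kQ/I; the G j represent the nonprojective indecomposable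
   Gorenstein-projective A-modules, and C is the endomorphism algebra of the
   direct sum of the e_v A and the G j. *)
Theorem theorem0p1 (k : closedFieldType) (Q : quiver) (I : ideal (path_alg k Q))
    (J : finType) (G : J -> rmod (rquot I)) :
  gentle I ->
  gp_complete (vertex_cidem I) G ->
  let A : pzRingType := rquot I in
  let C : pzRingType := CMA (vertex_cidem I) G in
  let eps : C := cma_eps (vertex_cidem I) G in
  let f : corner A eps := cma_corner (vertex_cidem I) G in
  [/\ (injective f /\ forall x : C, (exists a, f a = x) <-> eps * x * eps = x) /\
      standard_recollement f,
      forall X : rmod A, indecomposable X -> ~ projective X ->
        gorenstein_projective X ->
        forall v, iso X (gp_family (vertex_cidem I) G v) ->
          gorenstein_projective
            (res_functor f (right_ideal_rmod (cma_idem (vertex_cidem I) G v))) &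
      forall X : rmod A, indecomposable X -> ~ projective X ->
        gorenstein_projective X ->
        ~ gorenstein_projective (tensor_functor (epsC f) X)].
Proof.
move=> [Iadm _ _ _ _] complete A C eps f; have [kA _] := admissible_finite Iadm.
have famgp i : gorenstein_projective (gp_family (vertex_cidem I) G i).
  by have [/(_ i)[]] := complete.
have [kC kf] := cma_finite kA famgp.
have fI : injective f by exact: cma_corner_inj.
have fE (x : C) : (exists a, f a = x) <-> eps * x * eps = x by exact: cma_corner_image.
split.
- by split=> //; exact: (corner_recollement fI fE kf).
- move=> X _ _ _ v _; apply: gp_iso (famgp v); apply: iso_sym; exact: res_idem_iso.
by move=> X _ Xp Xgp; exact: (cma_tensor_not_gp kA complete Xgp Xp).
Qed.
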